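(* Let $V$ be a measurable function on $(-1,1)$ such that $V(x)\ge 0$ and $(1-x^2)V(x)\le M<\infty$ for a.e. $x\in(-1,1)$. Then for any $f\in(H_{00}^{1/2})^*$ there exists a unique weak solution $u\in H_{00}^{1/2}$ of the problem $$V(x)u(x)-\frac1{2\pi}\int_{-1}^1\frac{u'(t)}{t-x}\,dt=f(x),\qquad u(-1)=u(1)=0,$$ and it satisfies $$\|u\|_{H_{00}^{1/2}}\le(2\pi+2)\,\|f\|_{(H_{00}^{1/2})^*}.$$
   Context: Functions are complex-valued. The Fourier transform is $\widehat u(\zeta)=\int_{-\infty}^\infty u(x)e^{ix\zeta}dx$. $H_{00}^{1/2}=H_{00}^{1/2}(-1,1)$ is the subspace of the Sobolev space $H^{1/2}(\mathbb R)$ consisting of functions equal to zero a.e. outside $[-1,1]$, with norm $\|u\|^2_{H_{00}^{1/2}}=\frac1{2\pi}\int_{-\infty}^\infty(1+|\zeta|^2)^{1/2}|\widehat u(\zeta)|^2d\zeta$. The set $C_0^\infty(-1,1)$ is dense in it. $(H_{00}^{1/2})^*$ is the dual of $H_{00}^{1/2}$ with respect to the pairing $(f,g)=\int_{-1}^1f(x)\overline{g(x)}\,dx$ in $L_2(-1,1)$: it consists of distributions $f$ (anti-linear continuous functionals on $C_0^\infty(-1,1)$) that extend by continuity to bounded anti-linear functionals $g\mapsto(f,g)$ on $H_{00}^{1/2}$, with norm $\|f\|_{(H_{00}^{1/2})^*}=\sup_{0\ne g\in H_{00}^{1/2}}\frac{|(f,g)|}{\|g\|_{H_{00}^{1/2}}}$.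 A weak solution of the problem with $f\in(H_{00}^{1/2})^*$ is an element $u\in H_{00}^{1/2}$ satisfying $$\int_{-1}^1V(x)u(x)\overline{g(x)}\,dx+\frac1{4\pi}\int_{-\infty}^\infty|\zeta|\,\widehat u(\zeta)\overline{\widehat g(\zeta)}\,d\zeta=(f,g)\quad\text{for every } g\in H_{00}^{1/2}.$$ *)

(* Defs.v *)
From HB Require Import structures.
From mathcomp Require Export all_boot all_order all_algebra.
From mathcomp Require Export complex.
From mathcomp Require Export all_classical all_reals all_analysis.
From mathcomp Require Export measurable_realfun.

Set Implicit Arguments.
Unset Strict Implicit.
Unset Printing Implicit Defensive.

Import Order.TTheory GRing.Theory Num.Theory.
Import numFieldNormedType.Exports.

Local Open Scope classical_set_scope.
Local Open Scope ring_scope.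
Local Open Scope complex_scope.

Local Notation Re := complex.Re.
Local Notation Im := complex.Im.
(* The modulus as an element of R; the library's `|z| lives in R[i]. *)
Local Notation modulus := ComplexField.Normc.normc.

Section Complex_valued_functions.
Context {R : realType}.
Implicit Types (D : set R) (u v : R -> R[i]).
Local Notation mu := (@lebesgue_measure R).

(* Measurability with respect to the Lebesgue sigma-algebra; the library's
   default on R is the Borel sigma-algebra. *)
Definition lebesgue_measurable_fun D (f : R -> R) :=
  @measurable_fun _ _ (g_sigma_algebraType (completed_algebra_gen mu)) R D f.

Definition cmeasurable u :=
  measurable_fun setT (fun x => Re (u x)) /\
  measurable_fun setT (fun x => Im (u x)).

Definition cintegral D u : R[i] :=
  (\int[mu]_(x in D) Re (u x)) +i* (\int[mu]_(x in D) Im (u x)).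

Definition expi (t : R) : R[i] := cos t +i* sin t.

Definition fourier u (zeta : R) : R[i] :=
  cintegral setT (fun x => u x * expi (x * zeta)).

Definition cderive1n (k : nat) u (x : R) : R[i] :=
  derive1n k (fun y => Re (u y)) x +i* derive1n k (fun y => Im (u y)) x.

Definition csmooth u := forall (k : nat) (x : R),
  derivable (derive1n k (fun y => Re (u y))) x 1 /\
  derivable (derive1n k (fun y => Im (u y))) x 1.

Definition csupport u : set R := closure [set x | u x != 0].

Definition antilinear_on (H : set (R -> R[i])) (f : (R -> R[i]) -> R[i]) :=
  forall (a : R[i]) u v, H u -> H v ->
    f (fun x => a * u x + v x) = conjc a * f u + f v.

End Complex_valued_functions.

Section H00.
Context {R : realType}.
Implicit Types (u v g phi : R -> R[i]) (f F : (R -> R[i]) -> R[i]).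
Local Notation mu := (@lebesgue_measure R).

(* Elements are represented by Borel functions, identified when a.e. equal; every
   class of Lebesgue measurable functions has a Borel representative.  A square
   integrable function vanishing a.e. outside [-1, 1] is integrable, so its
   Fourier transform is given by the integral defining [fourier]. *)
Definition H00 : set (R -> R[i]) := [set u |
  [/\ cmeasurable u,
      (\int[mu]_x (modulus (u x) ^+ 2)%:E < +oo)%E,
      {ae mu, forall x, ~ `[-1, 1]%classic x -> u x = 0} &
      (\int[mu]_z (Num.sqrt (1 + z ^+ 2) * modulus (fourier u z) ^+ 2)%:E
         < +oo)%E]].

Definition H00_norm u : R :=
  Num.sqrt ((2 * pi)^-1 *
    \int[mu]_z (Num.sqrt (1 + z ^+ 2) * modulus (fourier u z) ^+ 2)).

Definition test_function : set (R -> R[i]) := [set phi |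
  [/\ csmooth phi, compact (csupport phi) &
      csupport phi `<=` `]-1, 1[%classic]].

Definition sup_norm u : R := sup [set modulus (u x) | x in setT].

(* Anti-linear functionals on the test functions, continuous in the usual
   topology of C_0^oo(-1, 1): on each compact K they are dominated by finitely
   many of the seminorms sup |phi^(k)|.  Values of f at functions that are not
   test functions play no role. *)
Definition distribution f :=
  antilinear_on test_function f /\
  forall K : set R, compact K -> K `<=` `]-1, 1[%classic ->
    exists (C : R) (N : nat), forall phi,
      test_function phi -> csupport phi `<=` K ->
      modulus (f phi) <= C * \sum_(k < N.+1) sup_norm (cderive1n k phi).

Definition H00_bounded F :=
  exists C : R, forall g, H00 g -> modulus (F g) <= C * H00_norm g.

Definition H00_extension f F :=
  [/\ antilinear_on H00 F, H00_bounded F &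
      forall phi, test_function phi -> F phi = f phi].

Definition H00_dual f := distribution f /\ exists F, H00_extension f F.

(* (f, g) for f in H00_dual and g in H00.  The extension is unique on H00 since
   the test functions are dense there, so the choice made by xget is harmless. *)
Definition pairing f : (R -> R[i]) -> R[i] :=
  xget (fun _ => 0) [set F | H00_extension f F].

Definition H00_dual_norm f : R :=
  sup [set modulus (pairing f g) / H00_norm g |
        g in [set g | H00 g /\ ~ (g = (fun _ => 0) %[ae mu])]].

(* For V Lebesgue but not Borel measurable the first integral is still the
   Lebesgue integral: the library integrates the positive and negative parts by
   taking the supremum over Borel simple functions below them, which is
   insensitive to changes on null sets. *)
Definition weak_solution (V : R -> R) f u :=
  H00 u /\
  forall g, H00 g ->
    cintegral `]-1, 1[%classic (fun x => (V x)%:C * u x * conjc (g x))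
    + ((4 * pi)^-1)%:C *
      cintegral setT
        (fun z => (`|z|)%:C * fourier u z * conjc (fourier g z))
    = pairing f g.

End H00.

(* Main.v *)
Require Import Defs.
From mathcomp Require Import all_boot all_order all_algebra.
From mathcomp Require Import all_classical all_reals all_analysis.
From mathcomp Require Import ring lra.
Import Order.TTheory GRing.Theory Num.Theory.
Import numFieldNormedType.Exports.

Set Implicit Arguments.
Unset Strict Implicit.
Unset Printing Implicit Defensive.

Local Open Scope classical_set_scope.
Local Open Scope ring_scope.

(** The solution is the Riesz representative of [(f, .)] for the quadratic form
    [Q u = \int V |u|^2 + (4 pi)^-1 \int |z| |fourier u z|^2], so everything rests
    on the coercivity of [Q] on H00.  Its source is Hardy's inequality
    [4 \int |u|^2 / (1 - x^2) <= \int |z| |fourier u z|^2], which also makes the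
    potential term bounded.  To obtain it, the Fourier transform is weighted with
    [exp (- e |z|)], whose transform is the Poisson kernel: the weighted integral of
    [|fourier u|^2] is at most [2 pi \int |u|^2] times the part of the Poisson mass
    at [x] that stays in [-1, 1], while the unweighted one is [2 pi \int |u|^2] by
    Plancherel's equality.  The mass that escapes is of order [e / (1 - x^2)], so
    that dividing the difference by [e] and letting [e] tend to 0 gives the claim.
    Real and imaginary parts separate throughout: the terms of [|fourier u|^2] that
    mix them are odd in [z], and all the weights are even. *)

(** Plancherel's equality appears as two separate inequalities. The weighted integral is computed
    exactly, up to a nonnegative double integral measuring the oscillation of the function.
    Discarding that term bounds the weighted integral from above; showing that it vanishes with [e]
    for a merely square integrable function is the main obstacle, and is settled by continuous
    approximation. The 4 in Hardy's inequality is the limit of the escaping mass divided by [e]: 2 /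
    (1 - x) + 2 / (1 + x) = 4 / (1 - x^2). With the factor (4 pi)^-1 of the form it bounds the
    integral of |u|^2 by pi Q u, and the squared norm by (pi + 2) Q u. Testing the equation with [u]
    itself and cancelling one factor of the norm yields the estimate. H00 is never made into a
    Hilbert space: Riesz's theorem is proved for a semidefinite real form on bare functions, and
    completeness comes from almost everywhere convergence of rapidly Cauchy sequences together with
    Fatou's lemma. The complex equation amounts to its real part for both [g] and [i g]. *)

(** * Real-valued Lebesgue integrals and their limit theorems *)

Section Integrable.
Context d (T : measurableType d) (R : realType) (mu : {measure set T -> \bar R}).
Implicit Types f g h : T -> R.

Lemma ae_mono (P Q : T -> Prop) : (forall x, P x -> Q x) ->
  {ae mu, forall x, P x} -> {ae mu, forall x, Q x}.
Proof. by move=> PQ; apply: filterS. Qed.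

Lemma ae_and (P Q : T -> Prop) : {ae mu, forall x, P x} -> {ae mu, forall x, Q x} ->
  {ae mu, forall x, P x /\ Q x}.
Proof. by apply: filterS2. Qed.

Definition intg f := mu.-integrable setT (EFin \o f).

Lemma intg_measurable f : intg f -> measurable_fun setT f.
Proof. by move=> /integrableP[/measurable_EFinP]. Qed.

Lemma intg_le f g : measurable_fun setT f -> (forall x, `|f x| <= g x) ->
  intg g -> intg f.
Proof.
move=> mf fg ig; apply: (le_integrable _ _ _ ig) => //; first exact/measurable_EFinP.
move=> x _ /=; rewrite lee_fin (le_trans (fg x))//; exact: ler_norm.
Qed.

Lemma intgD f g : intg f -> intg g -> intg (fun x => f x + g x).
Proof. by move=> jf jg; exact: (integrableD _ jf jg). Qed.

Lemma intgB f g : intg f -> intg g -> intg (fun x => f x - g x).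
Proof. by move=> jf jg; exact: (integrableB _ jf jg). Qed.

Lemma intgZ (c : R) f : intg f -> intg (fun x => c * f x).
Proof. by move=> jf; exact: (integrableZl _ c jf). Qed.

Lemma intg_bounded_mul f h (K : R) : intg f -> measurable_fun setT h ->
  (forall x, `|h x| <= K) -> intg (fun x => f x * h x).
Proof.
move=> jf mh hK; apply: (@intg_le _ (fun x => K * `|f x|)).
- exact: measurable_funM (intg_measurable jf) mh.
- by move=> x; rewrite normrM mulrC ler_wpM2r.
- by apply: intgZ; exact: (integrable_norm jf).
Qed.

Lemma intg_norm f : intg f -> intg (fun x => `|f x|).
Proof. by move=> /integrable_norm. Qed.

Lemma intg_lty f : measurable_fun setT f -> (forall x, 0 <= f x) ->
  (\int[mu]_x (f x)%:E < +oo)%E -> intg f.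
Proof.
move=> mf f0 fi; apply/integrableP; split; first exact/measurable_EFinP.
by under eq_integral do rewrite /= ger0_norm//.
Qed.

Lemma lty_intg f : (forall x, 0 <= f x) -> intg f ->
  (\int[mu]_x (f x)%:E < +oo)%E.
Proof.
by move=> f0 /integrableP[_]; under eq_integral do rewrite /= ger0_norm//.
Qed.

Lemma intg_EFin f : intg f ->
  (\int[mu]_x (f x)%:E)%E = (\int[mu]_x f x)%:E.
Proof. by move=> jf; rewrite fineK//; exact: (integrable_fin_num measurableT jf). Qed.

Lemma intg_mul_sqr f g : measurable_fun setT f -> measurable_fun setT g ->
  intg (fun x => f x ^+ 2) -> intg (fun x => g x ^+ 2) ->
  intg (fun x => f x * g x).
Proof.
move=> mf mg jf jg; apply: (@intg_le _ (fun x => f x ^+ 2 + g x ^+ 2)).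
- exact: measurable_funM.
- by move=> x; rewrite ler_norml; apply/andP; split; nra.
- exact: intgD.
Qed.

Lemma intg_sqrD (c : R) f g : measurable_fun setT f -> measurable_fun setT g ->
  intg (fun x => f x ^+ 2) -> intg (fun x => g x ^+ 2) ->
  intg (fun x => (f x + c * g x) ^+ 2).
Proof.
move=> mf mg jf jg.
rewrite (_ : (fun x => _) = (fun x => f x ^+ 2 + (2 * c) * (f x * g x)
   + c ^+ 2 * g x ^+ 2)).
  by apply: intgD (intgD jf (intgZ _ (intg_mul_sqr mf mg jf jg))) (intgZ _ jg).
by apply/funext => x; ring.
Qed.

Lemma ler_Rint f g : intg f -> intg g -> (forall x, f x <= g x) ->
  \int[mu]_x f x <= \int[mu]_x g x.
Proof. by move=> jf jg fg; apply: le_Rintegral. Qed.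

Lemma RintD f g : intg f -> intg g ->
  \int[mu]_x (f x + g x) = \int[mu]_x f x + \int[mu]_x g x.
Proof. by move=> jf jg; apply: RintegralD. Qed.

Lemma RintB f g : intg f -> intg g ->
  \int[mu]_x (f x - g x) = \int[mu]_x f x - \int[mu]_x g x.
Proof. by move=> jf jg; apply: RintegralB. Qed.

Lemma RintZ (c : R) f : intg f ->
  \int[mu]_x (c * f x) = c * \int[mu]_x f x.
Proof. by move=> jf; apply: RintegralZl. Qed.

Lemma ae_intg f g : measurable_fun setT g ->
  {ae mu, forall x, f x = g x} -> intg f -> intg g.
Proof.
move=> mg fg /integrableP[mf fi]; apply/integrableP; split.
  exact/measurable_EFinP.
have mg' : measurable_fun setT (EFin \o g) by exact/measurable_EFinP.
apply: le_lt_trans fi; rewrite le_eqVlt; apply/orP; left; apply/eqP.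
apply: ae_eq_integral => //.
- exact: measurableT_comp.
- exact: measurableT_comp.
- by apply: filterS fg => x /= -> _.
Qed.

Lemma ae_Rint f g : measurable_fun setT f -> measurable_fun setT g ->
  {ae mu, forall x, f x = g x} -> \int[mu]_x f x = \int[mu]_x g x.
Proof.
move=> mf mg fg; congr fine; apply: ae_eq_integral => //; try exact/measurable_EFinP.
by apply: filterS fg => x /= -> _.
Qed.

(** The minimum of [f] and [g] is an almost everywhere copy of [f] that lies below [g] at every
    point. *)
Lemma ae_ler_Rint f g : intg f -> intg g -> {ae mu, forall x, f x <= g x} ->
  \int[mu]_x f x <= \int[mu]_x g x.
Proof.
move=> jf jg fg.
have mf := intg_measurable jf; have mg := intg_measurable jg.
have mm : measurable_fun setT (fun x => Num.min (f x) (g x)) by exact: measurable_minr.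
have e : {ae mu, forall x, f x = Num.min (f x) (g x)}.
  by apply: filterS fg => x fgx; apply/esym/min_idPl.
rewrite (ae_Rint mf mm e); apply: ler_Rint => // [|x]; last by rewrite ge_min lexx orbT.
exact: ae_intg e jf.
Qed.

Lemma Rint_eq0_ae f : (forall x, 0 <= f x) -> intg f -> \int[mu]_x f x = 0 ->
  {ae mu, forall x, f x = 0}.
Proof.
move=> f0 jf f_0.
have mf := intg_measurable jf.
have : (\int[mu]_x `|(EFin \o f) x| = 0)%E.
  by under eq_integral do rewrite /= ger0_norm//; rewrite intg_EFin// f_0.
move/ae_eq_integral_abs => H; apply: filterS (H measurableT _).
  by move=> x /= /(_ I) [].
exact/measurable_EFinP.
Qed.

(** Integrability of the limit is a conclusion here. This is how the Hardy integral, the spectral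
    density and the limits in the completeness proof are seen to be finite. *)
Lemma fatou_Rint (f_ : nat -> T -> R) f (C_ : nat -> R) (C : R) :
  (forall n, intg (f_ n)) -> (forall n x, 0 <= f_ n x) ->
  measurable_fun setT f -> (forall x, 0 <= f x) ->
  {ae mu, forall x, f_ n x @[n --> \oo] --> f x} ->
  (forall n, \int[mu]_x f_ n x <= C_ n) -> C_ n @[n --> \oo] --> C ->
  intg f /\ \int[mu]_x f x <= C.
Proof.
move=> jf_ f_0 mf f0 cf fC CC.
have key : (\int[mu]_x (f x)%:E <= C%:E)%E.
  have mf_ n : measurable_fun setT (EFin \o f_ n).
    by apply/measurable_EFinP; exact: intg_measurable.
  (* The limit agrees almost everywhere with the lower limit, to which Fatou's lemma applies. *)
  rewrite (ae_eq_integral (fun x => limn_einf (fun n => (f_ n x)%:E)))//.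
  - have := fatou mu measurableT mf_ (fun n x _ => f_0 n x : (0 <= (f_ n x)%:E)%E).
    move=> /le_trans; apply.
    apply: (@le_trans _ _ (limn_einf (EFin \o C_))).
      rewrite !limn_einf_lim; apply: lee_lim.
      - exact: is_cvg_einfs.
      - exact: is_cvg_einfs.
      - apply: nearW => m; apply: le_ereal_inf_tmp => _ [k /= mk <-].
        apply: (@le_trans _ _ (\int[mu]_x (f_ k x)%:E)%E).
          by apply: ereal_inf_lbound; exists k.
        by rewrite intg_EFin// lee_fin.
    have cC : (EFin \o C_) n @[n --> \oo] --> C%:E by apply/cvg_EFin => //; exact: nearW.
    rewrite is_cvg_limn_einfE//; last by apply/cvg_ex; exists C%:E.
    by move/cvg_lim : cC => ->.
  - exact/measurable_EFinP.
  - rewrite (_ : (fun x => _) = (fun x => - limn_esup (fun n => - (f_ n x)%:E))%E).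
      apply: (measurableT_comp (f := @oppe R)) => //.
      apply: measurable_fun_limn_esup => n.
      exact: (measurableT_comp (f := @oppe R) _ (mf_ n)).
    by apply/funext => x; rewrite (limn_esupN (fun n => (f_ n x)%:E)) oppeK.
  - apply: filterS cf => x /= cfx _.
    have cC : (EFin \o (f_^~ x)) n @[n --> \oo] --> (f x)%:E.
      by apply/cvg_EFin => //; exact: nearW.
    rewrite is_cvg_limn_einfE//; last by apply/cvg_ex; exists (f x)%:E.
    by move/cvg_lim : cC => ->.
have jf : intg f by apply: intg_lty => //; exact: le_lt_trans key (ltry _).
by split => //; rewrite -lee_fin -intg_EFin.
Qed.

Lemma dominated_Rint (f_ : nat -> T -> R) f g :
  (forall n, measurable_fun setT (f_ n)) -> measurable_fun setT f ->
  {ae mu, forall x, f_ n x @[n --> \oo] --> f x} ->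
  intg g -> {ae mu, forall x n, `|f_ n x| <= g x} ->
  intg f /\ \int[mu]_x f_ n x @[n --> \oo] --> \int[mu]_x f x.
Proof.
move=> mf_ mf cf jg fg.
have [| | |||jf _ c] := @dominated_convergence _ T R mu setT measurableT
   (fun n => EFin \o f_ n) (EFin \o f) (EFin \o g).
- by move=> n; exact/measurable_EFinP.
- exact/measurable_EFinP.
- by apply: filterS cf => x cfx _; apply/cvg_EFin => //; exact: nearW.
- exact: jg.
- by apply: filterS fg => x fgx n _ /=; rewrite lee_fin.
split=> //; move: c; rewrite [X in _ --> X](intg_EFin jf) => c.
by have [_] := (fine_cvgP _ _).1 c.
Unshelve. all: by end_near.
Qed.
End Integrable.

(** * The Poisson kernel *)

Section PoissonKernel.
Context {R : realType}.
Local Notation mu := (@lebesgue_measure R).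
Implicit Types e t x z : R.

(** The Poisson kernel of the half-plane, scaled to total mass 2 pi so that it is the Fourier
    transform of [abel e] without any constant. *)
Definition poisson e t : R := 2 * e / (e ^+ 2 + t ^+ 2).

Definition abel e z : R := expR (- (e * `|z|)).

Lemma poisson_den_gt0 e t : 0 < e -> 0 < e ^+ 2 + t ^+ 2.
Proof. by move=> e0; rewrite ltr_pwDl ?exprn_gt0 ?sqr_ge0. Qed.

Lemma poisson_ge0 e t : 0 < e -> 0 <= poisson e t.
Proof.
by move=> e0; rewrite divr_ge0 ?ltW ?poisson_den_gt0// mulr_gt0.
Qed.

Lemma poisson_le e t : 0 < e -> poisson e t <= 2 / e.
Proof.
move=> e0; rewrite ler_pdivrMr ?poisson_den_gt0// mulrAC ler_pdivlMr//.
by have := sqr_ge0 t; lra.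
Qed.

Lemma continuous_poisson e : 0 < e -> continuous (poisson e).
Proof.
move=> e0 t; apply: cvgM; first exact: cvg_cst.
apply: cvgV; first by rewrite gt_eqF ?poisson_den_gt0.
apply: cvgD; first exact: cvg_cst.
exact: exprn_continuous.
Qed.

Lemma abel_ge0 e z : 0 <= abel e z.
Proof. exact: expR_ge0. Qed.

Lemma abel_le1 e z : 0 < e -> abel e z <= 1.
Proof. by move=> e0; rewrite -expR0 ler_expR oppr_le0 mulr_ge0// ltW. Qed.

Lemma continuous_abel e : continuous (abel e).
Proof.
move=> z; apply: continuous_comp; last exact: continuous_expR.
apply: continuousN; apply: continuousM; first exact: cst_continuous.
exact: norm_continuous.
Qed.

Lemma continuous_cosM t : continuous (fun z : R => cos (t * z)).
Proof.
move=> z; apply: continuous_comp; last exact: continuous_cos.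
by apply: continuousM; [exact: cst_continuous|exact: cvg_id].
Qed.

(** The summand 1 next to the cosine makes the integrand nonnegative, as the fundamental theorem of
    calculus on a half-line requires. Its contribution is subtracted again in
    [Rintegral_abel_cos]. *)
Lemma is_derive_abel_primitive e t z : 0 < e ->
  is_derive z 1 (fun z => expR (- (e * z)) *
     ((t * sin (t * z) - e * cos (t * z)) / (e ^+ 2 + t ^+ 2) - e^-1))
    ((1 + cos (t * z)) * expR (- (e * z))).
Proof.
move=> e0; have d0 := poisson_den_gt0 t e0.
apply: is_derive_eq; rewrite /GRing.scale /=.
by field; rewrite !gt_eqF.
Qed.

Lemma integral_half_abel_cos e t : 0 < e ->
  (\int[mu]_(z in `[0%R, +oo[) ((1 + cos (t * z)) * expR (- (e * z)))%:E
   = (e^-1 + poisson e t / 2)%:E)%E.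
Proof.
move=> e0; have d0 := poisson_den_gt0 t e0.
pose F z := expR (- (e * z)) *
     ((t * sin (t * z) - e * cos (t * z)) / (e ^+ 2 + t ^+ 2) - e^-1).
have dF z := @is_derive_abel_primitive e t z e0.
have cF z : {for z, continuous F}.
  by apply/differentiable_continuous/derivable1_diffP; case: (dF z).
have cf : continuous (fun z => (1 + cos (t * z)) * expR (- (e * z))).
  move=> z; apply/differentiable_continuous/derivable1_diffP.
  exact: ex_derive.
rewrite (@ge0_continuous_FTC2y _ _ F _ 0).
- rewrite /F !mulr0 oppr0 expR0 sin0 cos0 /poisson -EFinB; congr EFin.
  by field; rewrite !gt_eqF.
- move=> x _; rewrite mulr_ge0 ?expR_ge0//.
- by apply: continuous_subspaceT.
- have K0 : 0 <= (`|t| + e) / (e ^+ 2 + t ^+ 2) + e^-1.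
    have [e0' d0'] := (ltW e0, ltW d0).
    by apply: addr_ge0; [apply: divr_ge0 => //; exact: addr_ge0|rewrite invr_ge0].
  have ex : expR (- (e * z)) @[z --> +oo] --> (0 : R).
    apply: (@cvg_comp _ _ _ (fun z => e * z) (fun y => expR (- y)) _ +oo).
      exact: gt0_cvgMry.
    exact: cvgr_expR.
  apply: norm_cvg0.
  have H : expR (- (e * z)) * ((`|t| + e) / (e ^+ 2 + t ^+ 2) + e^-1)
      @[z --> +oo] --> (0 : R).
    by rewrite -[X in _ --> X](mul0r ((`|t| + e) / (e ^+ 2 + t ^+ 2) + e^-1)); apply: cvgMl.
  apply: (squeeze_cvgr _ (cvg_cst 0) H).
  apply: nearW => z; rewrite normr_ge0 /=.
  rewrite normrM ger0_norm ?expR_ge0// ler_wpM2l ?expR_ge0//.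
  rewrite (le_trans (ler_normB _ _))// lerD//; last by rewrite ger0_norm// invr_ge0 ltW.
  rewrite normrM [X in _ * X]ger0_norm ?invr_ge0 ?(ltW d0)//.
  rewrite ler_wpM2r ?invr_ge0 ?(ltW d0)//.
  rewrite (le_trans (ler_normB _ _))// lerD// normrM.
    by rewrite ler_piMr// sin_max.
  by rewrite ger0_norm ?(ltW e0)// ler_piMr// ?(ltW e0)// cos_max.
- by move=> x _; case: (dF x).
- by apply: cvg_at_right_filter; exact: cF.
- by move=> x _; rewrite derive1E; have [_ ->] := dF x.
Qed.

Lemma integral_abel_cos e t : 0 < e ->
  (\int[mu]_z ((1 + cos (t * z)) * abel e z)%:E
   = (2 / e + poisson e t)%:E)%E.
Proof.
move=> e0; rewrite ge0_symfun_integralT.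
- rewrite -set_itvcy.
  under eq_integral.
    move=> z; rewrite inE /= in_itv /= andbT => z0.
    rewrite /abel ger0_norm//.
    over.
  rewrite integral_half_abel_cos// -EFinM; congr EFin; field.
  by rewrite gt_eqF.
- move=> z; rewrite mulr_ge0 ?abel_ge0//.
- move=> z; apply: cvgM; last exact: continuous_abel.
  by apply: cvgD; [exact: cvg_cst|exact: continuous_cosM].
- by move=> z /=; rewrite mulrN cosN /abel normrN.
Qed.

Lemma measurable_abel e : measurable_fun setT (abel e).
Proof. apply: continuous_measurable_fun; exact: continuous_abel. Qed.

Lemma measurable_cosM t : measurable_fun setT (fun z : R => cos (t * z)).
Proof. apply: continuous_measurable_fun; exact: continuous_cosM. Qed.

Lemma intg_abel e : 0 < e -> intg mu (abel e).
Proof.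
move=> e0; have := integral_abel_cos 0 e0.
under eq_integral do rewrite mul0r cos0.
move=> H.
have : intg mu (fun z => (1 + 1) * abel e z).
  apply: intg_lty; last by rewrite H ltry.
    by apply: measurable_funM => //; exact: measurable_abel.
  by move=> z; rewrite mulr_ge0// abel_ge0.
move=> /(intgZ (1 + 1)^-1); congr (integrable _ _ _).
by apply/funext => z /=; congr EFin; field.
Qed.

Lemma Rintegral_abel_cos e t : 0 < e ->
  \int[mu]_z (cos (t * z) * abel e z) = poisson e t.
Proof.
move=> e0.
have jc s : intg mu (fun z => cos (s * z) * abel e z).
  apply: (intg_le _ _ (intg_abel e0)) => [|z].
    by apply: measurable_funM; [exact: measurable_cosM|exact: measurable_abel].
  by rewrite normrM (ger0_norm (abel_ge0 _ _)) ler_piMl ?abel_ge0// cos_max.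
have H s : \int[mu]_z abel e z + \int[mu]_z (cos (s * z) * abel e z)
    = 2 / e + poisson e s.
  rewrite -RintD//; last exact: intg_abel.
  under eq_Rintegral do rewrite -[X in X + _]mul1r -mulrDl.
  by rewrite /Rintegral integral_abel_cos.
have := H 0; under [X in _ + X = _]eq_Rintegral do rewrite mul0r cos0 mul1r.
have -> : poisson e 0 = 2 / e.
  by rewrite /poisson expr0n /= addr0; field; rewrite gt_eqF.
by have := H t; lra.
Qed.

Lemma sin_le_id t : 0 <= t -> sin t <= t.
Proof.
move=> t0.
have cs : {within `[0, t], continuous (@sin R)}.
  by apply: continuous_subspaceT => x; exact: continuous_sin.
have [c _] := @MVT_segment R sin cos 0 t t0 (fun x _ => is_derive_sin x) cs.
by rewrite sin0 !subr0 => ->; rewrite ler_piMl// cos_le1.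
Qed.

(** The sine of the right-hand angle is cos (atan t) = 1 / sqrt (1 + t^2), which dominates the
    left-hand side, and an angle is at least its sine. *)
Lemma pihalf_sub_atan_ge t : 0 <= t -> t / (1 + t ^+ 2) <= pi / 2 - atan t.
Proof.
move=> t0.
have D0 : 0 < 1 + t ^+ 2 by rewrite ltr_pwDl// sqr_ge0.
have s0 : 0 < Num.sqrt (1 + t ^+ 2) by rewrite sqrtr_gt0.
have h0 : 0 <= pi / 2 - atan t by rewrite subr_ge0 ltW ?atan_ltpi2.
apply: (@le_trans _ _ (Num.sqrt (1 + t ^+ 2))^-1).
  rewrite ler_pdivrMr// -{2}(sqr_sqrtr (ltW D0)) expr2 mulrA mulVf ?gt_eqF// mul1r.
  by rewrite -{1}(ger0_norm t0) -sqrtr_sqr ler_wsqrtr// lerDr.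
rewrite -cos_atan -cosN.
rewrite (_ : cos (- atan t) = cos ((pi / 2 - atan t) - pi / 2)); last by congr cos; ring.
by rewrite cosBpihalf sin_le_id.
Qed.

End PoissonKernel.

(** * Fubini's theorem for real-valued integrals *)

Section DoubleIntegral.
Context d1 d2 (T1 : measurableType d1) (T2 : measurableType d2) (R : realType).
Variable m1 : {sigma_finite_measure set T1 -> \bar R}.
Variable m2 : {sigma_finite_measure set T2 -> \bar R}.
Implicit Types (f : T1 -> R) (g : T2 -> R) (h : T1 * T2 -> R).
Local Notation m12 := (m1 \x m2)%E.

Lemma intg_tensor f g h (K : R) : intg m1 f -> intg m2 g ->
  measurable_fun setT h -> (forall p, `|h p| <= K) ->
  intg m12 (fun p => f p.1 * g p.2 * h p).
Proof.
move=> jf jg mh hK; apply: (intg_bounded_mul (K := K)) => //.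
have mf : measurable_fun setT (fun p : T1 * T2 => f p.1).
  exact: (measurableT_comp (intg_measurable jf) measurable_fst).
have mg : measurable_fun setT (fun p : T1 * T2 => g p.2).
  exact: (measurableT_comp (intg_measurable jg) measurable_snd).
apply/(integrable12ltyP m1 m2 (f := fun p => (f p.1 * g p.2)%:E)).
  by apply/measurable_EFinP; exact: measurable_funM.
under eq_integral.
  move=> x _.
  under eq_integral do rewrite /= normrM EFinM.
  rewrite ge0_integralZl//; last 1 first.
    by apply/measurable_EFinP; apply: measurableT_comp => //; exact: intg_measurable jg.
  rewrite (intg_EFin (intg_norm jg)) -EFinM.
  over.
rewrite /= (intg_EFin (f := fun x => `|f x| * \int[m2]_y `|g y|)) ?ltry//.
rewrite (_ : (fun x => _) = (fun x => (\int[m2]_y `|g y|) * `|f x|)).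
  exact/intgZ/intg_norm.
by apply/funext => x; rewrite mulrC.
Qed.

(** Since every section is integrable, and not just almost every one, the inner real integral agrees
    with the extended one at each point. *)
Lemma intg_prod1 h : intg m12 h -> (forall x, intg m2 (fun y => h (x, y))) ->
  intg m1 (fun x => \int[m2]_y h (x, y)) /\
  \int[m12]_p h p = \int[m1]_x \int[m2]_y h (x, y).
Proof.
move=> jh jx.
have E : fubini_F m2 (EFin \o h) = EFin \o (fun x => \int[m2]_y h (x, y)).
  by apply/funext => x; rewrite /fubini_F /= -(intg_EFin (jx x)).
split; first by have := integrable_fubini_F jh; rewrite E.
by have := integral12_prod_meas1 jh; rewrite E => H; rewrite /Rintegral -H.
Qed.

Lemma intg_prod2 h : intg m12 h -> (forall y, intg m1 (fun x => h (x, y))) ->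
  intg m2 (fun y => \int[m1]_x h (x, y)) /\
  \int[m12]_p h p = \int[m2]_y \int[m1]_x h (x, y).
Proof.
move=> jh jy.
have E : fubini_G m1 (EFin \o h) = EFin \o (fun y => \int[m1]_x h (x, y)).
  by apply/funext => y; rewrite /fubini_G /= -(intg_EFin (jy y)).
split; last first.
  by have := integral21_prod_meas1 jh; rewrite E => H; rewrite /Rintegral -H.
have mG : measurable_fun setT (fubini_G m1 (EFin \o h)) by exact: measurable_fubini_G jh.
rewrite E in mG; apply/integrableP; split => //.
have mh := measurable_int _ jh.
have jn := (integrable21ltyP m1 m2 mh).1 jh.
apply: le_lt_trans jn; apply: ge0_le_integral => //.
- exact: (measurableT_comp (f := @abse R)).
- apply: (measurable_fun_fubini_tonelli_G (abse \o (EFin \o h))).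
    exact: measurableT_comp.
  by move=> ?; exact: abse_ge0.
- move=> y _ /=.
  have := le_normr_Rintegral measurableT (jy y).
  by rewrite -lee_fin -(intg_EFin (intg_norm (jy y))).
Qed.

(** A tensor product of integrable functions times a bounded kernel: the shape of the double
    integrals below, where the kernel is a cosine, a sine, the Poisson kernel or a constant. *)
Lemma double_Rintegral f g h (K : R) : intg m1 f -> intg m2 g ->
  measurable_fun setT h -> (forall p, `|h p| <= K) ->
  [/\ intg m1 (fun x => f x * \int[m2]_y (g y * h (x, y))),
      intg m2 (fun y => g y * \int[m1]_x (f x * h (x, y))),
      \int[m12]_p (f p.1 * g p.2 * h p) =
        \int[m1]_x (f x * \int[m2]_y (g y * h (x, y))) &
      \int[m12]_p (f p.1 * g p.2 * h p) =
        \int[m2]_y (g y * \int[m1]_x (f x * h (x, y)))].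
Proof.
move=> jf jg mh hK.
have jh := intg_tensor jf jg mh hK.
have j1 x : intg m2 (fun y => g y * h (x, y)).
  by apply: (intg_bounded_mul (K := K)) => //; exact: measurable_fun_pair2.
have j2 y : intg m1 (fun x => f x * h (x, y)).
  by apply: (intg_bounded_mul (K := K)) => //; exact: measurable_fun_pair1.
have E1 : (fun x => \int[m2]_y (f x * g y * h (x, y))) =
          (fun x => f x * \int[m2]_y (g y * h (x, y))).
  apply/funext => x; rewrite -RintZ//.
  by apply: eq_Rintegral => y _; rewrite mulrA.
have E2 : (fun y => \int[m1]_x (f x * g y * h (x, y))) =
          (fun y => g y * \int[m1]_x (f x * h (x, y))).
  apply/funext => y; rewrite -RintZ//.
  by apply: eq_Rintegral => x _; rewrite mulrA [g y * _]mulrC.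
have [|H1 H1'] := intg_prod1 jh.
  move=> x; have := intgZ (f x) (j1 x); congr intg.
  by apply/funext => y; rewrite mulrA.
have [|H2 H2'] := intg_prod2 jh.
  move=> y; have := intgZ (g y) (j2 y); congr intg.
  by apply/funext => x; rewrite mulrA [g y * _]mulrC.
rewrite /= E1 in H1 H1'; rewrite /= E2 in H2 H2'.
by split.
Qed.

End DoubleIntegral.

(** * The Poisson identity and Plancherel's equality *)

Section SpectralDensity.
Context {R : realType}.
Local Notation mu := (@lebesgue_measure R).
Implicit Types (a : R -> R) (k : R * R -> R) (e x y z : R).

Definition kernel_transform k a z : R := \int[mu]_x (a x * k (x, z)).

Lemma intg_kernel k a z : measurable_fun setT k -> (forall p, `|k p| <= 1) ->
  intg mu a -> intg mu (fun x => a x * k (x, z)).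
Proof.
move=> mk k1 ja; apply: (intg_bounded_mul (K := 1)) => //.
exact: measurable_fun_pair1.
Qed.

Lemma kernel_transform_bounded k a z : measurable_fun setT k ->
  (forall p, `|k p| <= 1) -> intg mu a ->
  `|kernel_transform k a z| <= \int[mu]_x `|a x|.
Proof.
move=> mk k1 ja; have jk := intg_kernel z mk k1 ja.
apply: le_trans (le_normr_Rintegral measurableT jk) _.
apply: ler_Rint; [exact: intg_norm jk|exact: intg_norm|move=> x].
by rewrite normrM ler_piMr.
Qed.

(** Fubini's theorem needs an integrable weight in [z]. The weight [abel 1] serves, and being
    positive it can be divided out afterwards. *)
Lemma measurable_kernel_transform k a : measurable_fun setT k ->
  (forall p, `|k p| <= 1) -> intg mu a ->
  measurable_fun setT (kernel_transform k a).
Proof.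
move=> mk k1 ja.
have [_ j2 _ _] := double_Rintegral ja (intg_abel (@ltr01 R)) mk k1.
rewrite (_ : kernel_transform k a = fun z => (abel 1 z)^-1 *
    (abel 1 z * kernel_transform k a z)).
  apply: measurable_funM; last exact: intg_measurable j2.
  have -> : (fun z : R => (abel 1 z)^-1) = (fun z => expR `|z|).
    by apply/funext => z; rewrite /abel mul1r expRN invrK.
  by apply: measurableT_comp => //; exact: measurable_expR.
by apply/funext => z; rewrite mulrA mulVf ?mul1r// gt_eqF// expR_gt0.
Qed.

(** Fubini's theorem is used once per factor of the square: the first time one factor stays attached
    to the weight [w], the second time it is expanded as well. *)
Lemma kernel_transform_sqr k a w : measurable_fun setT k ->
  (forall p, `|k p| <= 1) -> intg mu a -> intg mu w ->
  [/\ intg mu (fun z => kernel_transform k a z ^+ 2 * w z),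
   forall x, intg mu (fun y => a y * \int[mu]_z (w z * k (x, z) * k (y, z))),
   intg mu (fun x => a x * \int[mu]_y (a y *
     \int[mu]_z (w z * k (x, z) * k (y, z)))) &
   \int[mu]_z (kernel_transform k a z ^+ 2 * w z) =
   \int[mu]_x (a x * \int[mu]_y (a y *
     \int[mu]_z (w z * k (x, z) * k (y, z))))].
Proof.
move=> mk k1 ja jw.
have mT := measurable_kernel_transform mk k1 ja.
have bT z := kernel_transform_bounded z mk k1 ja.
have jTw : intg mu (fun z => w z * kernel_transform k a z) by exact: intg_bounded_mul jw mT bT.
have [H1 H2 H3 H4] := double_Rintegral ja jTw mk k1.
have jwk x : intg mu (fun z => w z * k (x, z)).
  apply: (intg_bounded_mul (K := 1)) => //.
  exact: measurable_fun_pair2.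
have D x := double_Rintegral ja (jwk x) mk k1.
have E x : \int[mu]_z (w z * kernel_transform k a z * k (x, z)) =
   \int[mu]_y (a y * \int[mu]_z (w z * k (x, z) * k (y, z))).
  have [_ _ D1 D2] := D x; rewrite -D1 D2.
  by apply: eq_Rintegral => z _; rewrite -!mulrA; congr (_ * _); rewrite mulrC.
have E' : (fun x => a x * \int[mu]_z (w z * kernel_transform k a z * k (x, z))) =
   (fun x => a x * \int[mu]_y (a y * \int[mu]_z (w z * k (x, z) * k (y, z)))).
  by apply/funext => x; rewrite E.
have E2 : (fun z => w z * kernel_transform k a z * kernel_transform k a z) =
    (fun z => kernel_transform k a z ^+ 2 * w z).
  by apply/funext => z; rewrite -mulrA -expr2 mulrC.
rewrite E' in H1 H3; rewrite E2 in H2 H4.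
split => //; first by move=> x; have [] := D x.
by rewrite -H4 H3.
Qed.

Definition cos_transform a z : R := \int[mu]_x (a x * cos (x * z)).
Definition sin_transform a z : R := \int[mu]_x (a x * sin (x * z)).
(** This is the squared modulus of the Fourier transform of the real-valued [a]. *)
Definition spectral_density a z : R := cos_transform a z ^+ 2 + sin_transform a z ^+ 2.

Lemma measurable_cos_kernel : measurable_fun setT (fun p : R * R => cos (p.1 * p.2)).
Proof.
apply: (measurableT_comp (f := @cos R)).
  by apply: continuous_measurable_fun => x; exact: continuous_cos.
by apply: measurable_funM; [exact: measurable_fst|exact: measurable_snd].
Qed.

Lemma measurable_sin_kernel : measurable_fun setT (fun p : R * R => sin (p.1 * p.2)).
Proof.
apply: (measurableT_comp (f := @sin R)).
  by apply: continuous_measurable_fun => x; exact: continuous_sin.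
by apply: measurable_funM; [exact: measurable_fst|exact: measurable_snd].
Qed.

Let mc := measurable_cos_kernel.
Let ms := measurable_sin_kernel.
Let c1 (p : R * R) : `|cos (p.1 * p.2)| <= 1. Proof. exact: cos_max. Qed.
Let s1 (p : R * R) : `|sin (p.1 * p.2)| <= 1. Proof. exact: sin_max. Qed.

Lemma intg_mul_cos a z : intg mu a -> intg mu (fun x => a x * cos (x * z)).
Proof. exact: (@intg_kernel _ a z mc c1). Qed.

Lemma intg_mul_sin a z : intg mu a -> intg mu (fun x => a x * sin (x * z)).
Proof. exact: (@intg_kernel _ a z ms s1). Qed.

Lemma measurable_cos_transform a : intg mu a -> measurable_fun setT (cos_transform a).
Proof. exact: (measurable_kernel_transform mc c1). Qed.

Lemma measurable_sin_transform a : intg mu a -> measurable_fun setT (sin_transform a).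
Proof. exact: (measurable_kernel_transform ms s1). Qed.

Lemma spectral_density_ge0 a z : 0 <= spectral_density a z.
Proof. by rewrite addr_ge0 ?sqr_ge0. Qed.

Lemma measurable_spectral_density a : intg mu a ->
  measurable_fun setT (spectral_density a).
Proof.
move=> ja; apply: measurable_funD; apply: measurable_funX.
  exact: measurable_cos_transform.
exact: measurable_sin_transform.
Qed.

(** The cosine and sine products add up to cos ((x - y) z), whose integral against [abel e] is the
    Poisson kernel at x - y. *)
Lemma poisson_identity a e : 0 < e -> intg mu a ->
  intg mu (fun z => spectral_density a z * abel e z) /\
  \int[mu]_z (spectral_density a z * abel e z) =
  \int[mu]_x (a x * \int[mu]_y (a y * poisson e (x - y))).
Proof.
move=> e0 ja; have jw := intg_abel e0.
have [C1 C2 C3 C4] := kernel_transform_sqr mc c1 ja jw.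
have [S1 S2 S3 S4] := kernel_transform_sqr ms s1 ja jw.
have -> : (fun z => spectral_density a z * abel e z) =
    (fun z => cos_transform a z ^+ 2 * abel e z + sin_transform a z ^+ 2 * abel e z).
  by apply/funext => z; rewrite mulrDl.
split; first exact: intgD C1 S1.
rewrite (RintD C1 S1) C4 S4 -RintD//.
apply: eq_Rintegral => x _; rewrite -mulrDr -RintD//.
congr (_ * _); apply: eq_Rintegral => y _; rewrite -mulrDr -RintD /=.
- congr (_ * _); rewrite -Rintegral_abel_cos//; apply: eq_Rintegral => z _.
  by rewrite mulrBl cosB; ring.
- apply: (intg_bounded_mul (K := 1)); first apply: (intg_bounded_mul (K := 1)) => //.
  + exact: (measurable_fun_pair2 _ mc).
  + by move=> z; exact: cos_max.
  + exact: (measurable_fun_pair2 _ mc).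
  + by move=> z; exact: cos_max.
- apply: (intg_bounded_mul (K := 1)); first apply: (intg_bounded_mul (K := 1)) => //.
  + exact: (measurable_fun_pair2 _ ms).
  + by move=> z; exact: sin_max.
  + exact: (measurable_fun_pair2 _ ms).
  + by move=> z; exact: sin_max.
Qed.

End SpectralDensity.

(** * Functions supported in [-1, 1] and the Poisson mass of the interval *)

Section PoissonEnergy.
Context {R : realType}.
Local Notation mu := (@lebesgue_measure R).
Local Notation mu2 := (mu \x mu)%E.
Implicit Types (a f : R -> R) (e x y z : R).

Definition chi x : R := \1_`[-1, 1]%classic x.

(** Vanishing is required at every point, so that [chi] can be inserted into identities without
    exceptional sets. *)
Definition supported a := forall x, ~ `[-1, 1]%classic x -> a x = 0.

Definition sq_integrable a :=
  [/\ measurable_fun setT a, intg mu (fun x => a x ^+ 2) & supported a].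

Lemma chi_in x : `[-1, 1]%classic x -> chi x = 1.
Proof. by move=> xI; rewrite /chi indicE mem_set. Qed.

Lemma chi_out x : ~ `[-1, 1]%classic x -> chi x = 0.
Proof. by move=> xI; rewrite /chi indicE memNset. Qed.

Lemma chi_ge0 x : 0 <= chi x. Proof. by rewrite /chi indicE. Qed.

Lemma chi_le1 x : chi x <= 1. Proof. by rewrite /chi indicE lern1 leq_b1. Qed.

Lemma measurable_chi : measurable_fun setT chi.
Proof. exact: measurable_indic. Qed.

Lemma integral_chi : (\int[mu]_x (chi x)%:E = 2%:E)%E.
Proof.
have H : mu `[-1, 1]%classic = 2%:E.
  by rewrite lebesgue_measure_itv /= lte_fin -EFinB ifT; [congr EFin; ring|lra].
by rewrite integral_indic// setIT.
Qed.

Lemma intg_chi : intg mu chi.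
Proof.
apply: intg_lty; [exact: measurable_chi|exact: chi_ge0|].
by rewrite integral_chi ltry.
Qed.

Lemma supported_chi a x : supported a -> a x * chi x = a x.
Proof.
move=> sa; have [xI|xI] := pselect (`[-1, 1]%classic x).
  by rewrite chi_in// mulr1.
by rewrite sa// mul0r.
Qed.

Lemma sq_integrable_intg a : sq_integrable a -> intg mu a.
Proof.
move=> [ma ja sa]; apply: (@intg_le _ _ _ mu _ (fun x => a x ^+ 2 + chi x)) => //.
  move=> x; rewrite -{1}(supported_chi x sa) normrM (ger0_norm (chi_ge0 x)).
  have [xI|xI] := pselect (`[-1, 1]%classic x).
    rewrite chi_in// mulr1 -(real_normK (num_real (a x))).
    by have := sqr_ge0 (`|a x| - 1); have := sqr_ge0 `|a x|; lra.
  by rewrite chi_out// mulr0 addr0 sqr_ge0.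
exact: intgD ja intg_chi.
Qed.

Lemma sq_integrableD (c : R) a b : sq_integrable a -> sq_integrable b ->
  sq_integrable (fun x => a x + c * b x).
Proof.
move=> [ma ja sa] [mb jb sb]; split; last by move=> x xI; rewrite sa// sb// mulr0 addr0.
  by apply: measurable_funD => //; exact: measurable_funM.
exact: intg_sqrD.
Qed.

Lemma measurable_poisson_kernel e : 0 < e ->
  measurable_fun setT (fun p : R * R => poisson e (p.1 - p.2)).
Proof.
move=> e0; apply: (measurableT_comp (f := poisson e)).
  by apply: continuous_measurable_fun; exact: continuous_poisson.
by apply: measurable_funB; [exact: measurable_fst|exact: measurable_snd].
Qed.

Lemma poisson_norm e x : 0 < e -> `|poisson e x| <= 2 / e.
Proof. by move=> e0; rewrite ger0_norm ?poisson_ge0 ?poisson_le. Qed.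

Lemma poissonN e x : poisson e (- x) = poisson e x.
Proof. by rewrite /poisson sqrrN. Qed.

Definition mass e x : R := \int[mu]_y (chi y * poisson e (x - y)).

Lemma massE e x : 0 < e ->
  mass e x = 2 * (atan ((1 - x) / e) + atan ((1 + x) / e)).
Proof.
move=> e0; pose F y : R := - 2 * atan ((x - y) / e).
have dF y : is_derive y 1 F (poisson e (x - y)).
  have D0 := poisson_den_gt0 (x - y) e0.
  have D1 : 0 < 1 + ((x - y) / e) ^+ 2 by rewrite ltr_pwDl// sqr_ge0.
  rewrite /F; apply: is_derive_eq; rewrite /GRing.scale /= /poisson.
  field; rewrite !gt_eqF//.
have cF y : {for y, continuous F}.
  by apply/differentiable_continuous/derivable1_diffP; case: (dF y).
have cp : continuous (fun y => poisson e (x - y)).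
  move=> y; apply: (@continuous_comp _ _ _ (fun y => x - y)); last exact: continuous_poisson.
  by apply: cvgB; [exact: cvg_cst|exact: cvg_id].
rewrite /mass.
have -> : \int[mu]_y (chi y * poisson e (x - y)) =
          \int[mu]_(y in `[-1, 1]) poisson e (x - y).
  rewrite [RHS]Rintegral_mkcond; apply: eq_Rintegral => y _.
  rewrite patchE; case: ifPn => [/set_mem yI|/negP yI].
    by rewrite chi_in// mul1r.
  by rewrite chi_out ?mul0r// => /mem_set.
rewrite /Rintegral (@continuous_FTC2 _ _ F)//.
- rewrite /F /=.
  have -> : (x - 1) / e = - ((1 - x) / e) by ring.
  have -> : (x - -1) / e = (1 + x) / e by ring.
  by rewrite atanN; ring.
- exact: continuous_subspaceT.
- split.
  + by move=> y _; case: (dF y).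
  + by apply: cvg_at_right_filter; exact: cF.
  + by apply: cvg_at_left_filter; exact: cF.
- by move=> y _; rewrite derive1E; have [_ ->] := dF y.
Qed.

Lemma mass_ge0 e x : 0 < e -> 0 <= mass e x.
Proof.
move=> e0; apply: Rintegral_ge0 => y _.
by rewrite mulr_ge0 ?chi_ge0 ?poisson_ge0.
Qed.

Lemma mass_le e x : 0 < e -> mass e x <= 2 * pi.
Proof.
move=> e0; rewrite massE//.
have := atan_ltpi2 ((1 - x) / e); have := atan_ltpi2 ((1 + x) / e); lra.
Qed.

(** Beyond an endpoint at distance [s] from [x] lies the mass 2 (pi / 2 - atan (s / e)), and
    [pihalf_sub_atan_ge] at s / e bounds it from below. *)
Lemma mass_defect e x : 0 < e -> `[-1, 1]%classic x ->
  2 * ((1 - x) / (e ^+ 2 + (1 - x) ^+ 2) + (1 + x) / (e ^+ 2 + (1 + x) ^+ 2)) * e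
  <= 2 * pi - mass e x.
Proof.
move=> e0; rewrite /= in_itv /= => /andP[x1 x2]; rewrite massE//.
have H s : 0 <= s -> s / (e ^+ 2 + s ^+ 2) * e <= pi / 2 - atan (s / e).
  move=> s0; have D0 := poisson_den_gt0 s e0.
  apply: le_trans (pihalf_sub_atan_ge _); last by rewrite divr_ge0 ?(ltW e0).
  have D1 : 0 < 1 + (s / e) ^+ 2 by rewrite ltr_pwDl// sqr_ge0.
  rewrite le_eqVlt; apply/orP; left; apply/eqP.
  by field; rewrite !gt_eqF.
have := H (1 - x) ltac:(lra); have := H (1 + x) ltac:(lra); lra.
Qed.

Lemma cvg_mass (e_ : nat -> R) x : (forall n, 0 < e_ n) -> e_ n @[n --> \oo] --> 0 ->
  -1 < x < 1 -> mass (e_ n) x @[n --> \oo] --> 2 * pi.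
Proof.
move=> e0 ce /andP[x1 x2].
have H s : 0 < s -> atan (s / e_ n) @[n --> \oo] --> pi / 2.
  move=> s0.
  have ce' : (e_ n)^-1 @[n --> \oo] --> +oo.
    apply/gtr0_cvgV0; first by apply: nearW => n /=; rewrite invr_gt0.
    by apply: cvg_trans ce; apply: near_eq_cvg; apply: nearW => n /=; rewrite invrK.
  have ca : atan (s * y) @[y --> +oo] --> pi / 2.
    apply: (@cvg_comp _ _ _ (fun y => s * y) atan _ +oo); last exact: cvgy_atan.
    exact: gt0_cvgMry.
  exact: (cvg_comp _ _ ce' ca).
have E : (fun n => mass (e_ n) x) =
    (fun n => 2 * (atan ((1 - x) / e_ n) + atan ((1 + x) / e_ n))).
  by apply/funext => n; rewrite massE.
rewrite E (_ : 2 * pi = 2 * (pi / 2 + pi / 2)); last by field.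
apply: cvgMl_tmp; apply: cvgD; apply: H; lra.
Qed.
End PoissonEnergy.

(** * The energy identity and Bessel's inequality *)

Section EnergyIdentity.
Context {R : realType}.
Local Notation mu := (@lebesgue_measure R).
Local Notation mu2 := (mu \x mu)%E.
Implicit Types (a f g : R -> R) (e x y z : R).

Lemma intg_poisson_tensor e f g : 0 < e -> intg mu f -> intg mu g ->
  intg mu2 (fun p => f p.1 * g p.2 * poisson e (p.1 - p.2)).
Proof.
move=> e0 jf jg.
exact: (intg_tensor jf jg (measurable_poisson_kernel e0) (fun p => poisson_norm _ e0)).
Qed.

Lemma Rintegral_poisson_chi e f : 0 < e -> intg mu f ->
  [/\ intg mu (fun x => f x * mass e x),
   \int[mu2]_p (f p.1 * chi p.2 * poisson e (p.1 - p.2)) = \int[mu]_x (f x * mass e x) &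
   \int[mu2]_p (chi p.1 * f p.2 * poisson e (p.1 - p.2)) = \int[mu]_x (f x * mass e x)].
Proof.
move=> e0 jf.
have mk := measurable_poisson_kernel e0.
have bk (p : R * R) : `|poisson e (p.1 - p.2)| <= 2 / e by exact: poisson_norm.
have [H1 _ H3 _] := double_Rintegral jf intg_chi mk bk.
have [_ _ _ H4] := double_Rintegral intg_chi jf mk bk.
split; [exact: H1|exact: H3|rewrite H4]; apply: eq_Rintegral => x _; congr (_ * _).
by apply: eq_Rintegral => y _ /=; rewrite -[y - x]opprB poissonN.
Qed.

Definition oscillation e a : R :=
  \int[mu2]_p (chi p.1 * chi p.2 * ((a p.1 - a p.2) ^+ 2 * poisson e (p.1 - p.2))).

Lemma oscillation_ge0 e a : 0 < e -> 0 <= oscillation e a.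
Proof.
move=> e0; apply: Rintegral_ge0 => p _.
by apply: mulr_ge0; apply: mulr_ge0; rewrite ?chi_ge0 ?sqr_ge0 ?poisson_ge0.
Qed.

(** Substitute 2 a(x) a(y) = a(x)^2 + a(y)^2 - (a(x) - a(y))^2 in [poisson_identity]. As the kernel
    is symmetric, both pure squares integrate to [a ^+ 2] against [mass e]. *)
Lemma energy_identity e a : 0 < e -> sq_integrable a ->
  [/\ intg mu2 (fun p => chi p.1 * chi p.2 *
        ((a p.1 - a p.2) ^+ 2 * poisson e (p.1 - p.2))),
   intg mu (fun z => spectral_density a z * abel e z) &
   \int[mu]_z (spectral_density a z * abel e z) =
   \int[mu]_x (a x ^+ 2 * mass e x) - oscillation e a / 2].
Proof.
move=> e0 sa; have ja := sq_integrable_intg sa; have [ma ja2 supp] := sa.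
have [P1 P2] := poisson_identity e0 ja.
have mk := measurable_poisson_kernel e0.
have bk (p : R * R) : `|poisson e (p.1 - p.2)| <= 2 / e by exact: poisson_norm.
have [_ _ H _] := double_Rintegral ja ja mk bk.
have [_ K1 K2] := Rintegral_poisson_chi e0 ja2.
have J1 := intg_poisson_tensor e0 ja ja.
have J2 := intg_poisson_tensor e0 ja2 intg_chi.
have J3 := intg_poisson_tensor e0 intg_chi ja2.
have E : (fun p => chi p.1 * chi p.2 *
        ((a p.1 - a p.2) ^+ 2 * poisson e (p.1 - p.2))) =
   (fun p => a p.1 ^+ 2 * chi p.2 * poisson e (p.1 - p.2) +
        chi p.1 * a p.2 ^+ 2 * poisson e (p.1 - p.2) -
        2 * (a p.1 * a p.2 * poisson e (p.1 - p.2))).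
  apply/funext => -[x y] /=.
  (* With [a] written as [a] times [chi], the identity is algebra for each value of the two
     indicators. *)
  by rewrite -(supported_chi x supp) -(supported_chi y supp) /chi !indicE;
    case: (_ \in _); case: (_ \in _) => /=; ring.
rewrite /oscillation E P2.
split; [exact: intgB (intgD J2 J3) (intgZ 2 J1)|exact: P1|].
rewrite (RintB (intgD J2 J3) (intgZ 2 J1)) (RintD J2 J3) (RintZ 2 J1).
by rewrite K1 K2 H /=; field.
Qed.

Lemma bessel_mass e a : 0 < e -> sq_integrable a ->
  \int[mu]_z (spectral_density a z * abel e z) <= \int[mu]_x (a x ^+ 2 * mass e x).
Proof.
move=> e0 sa; have [_ _ ->] := energy_identity e0 sa.
by rewrite gerBl divr_ge0// oscillation_ge0.
Qed.

Lemma intg_mul_mass e f : 0 < e -> intg mu f -> intg mu (fun x => f x * mass e x).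
Proof. by move=> e0 jf; have [] := Rintegral_poisson_chi e0 jf. Qed.

Lemma le_Rintegral_mass e f : 0 < e -> (forall x, 0 <= f x) -> intg mu f ->
  \int[mu]_x (f x * mass e x) <= 2 * pi * \int[mu]_x f x.
Proof.
move=> e0 f0 jf; rewrite -RintZ//; apply: ler_Rint => [||x].
- exact: intg_mul_mass.
- exact: intgZ.
- by rewrite mulrC ler_wpM2r// mass_le.
Qed.

Lemma cvg_invS : (n.+1%:R : R)^-1 @[n --> \oo] --> 0.
Proof. exact: (@cvg_harmonic R). Qed.

Lemma cvg_abel (e_ : nat -> R) z : e_ n @[n --> \oo] --> 0 ->
  abel (e_ n) z @[n --> \oo] --> (1 : R).
Proof.
move=> ce; rewrite -[X in _ --> X]expR0.
have c : - (e_ n * `|z|) @[n --> \oo] --> (0 : R).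
  rewrite -[X in _ --> X]oppr0 -[X in _ --> - X](mul0r `|z|).
  by apply: cvgN; apply: cvgMr_tmp.
rewrite /abel; apply: (cvg_comp _ _ c); exact: continuous_expR.
Qed.

(** The half of Plancherel's equality that follows from Fatou's lemma as [e] tends to 0. It also
    makes the spectral density integrable, which the other half relies on. *)
Lemma bessel a : sq_integrable a ->
  intg mu (spectral_density a) /\
  \int[mu]_z spectral_density a z <= 2 * pi * \int[mu]_x (a x ^+ 2).
Proof.
move=> sa; have ja := sq_integrable_intg sa; have [ma ja2 supp] := sa.
have e0 n : 0 < (n.+1%:R : R)^-1 by rewrite invr_gt0.
apply: (@fatou_Rint _ _ _ mu (fun n z => spectral_density a z * abel n.+1%:R^-1 z)
  _ (fun=> 2 * pi * \int[mu]_x (a x ^+ 2))).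
- by move=> n; have [] := energy_identity (e0 n) sa.
- by move=> n z; rewrite mulr_ge0 ?spectral_density_ge0 ?abel_ge0.
- exact: measurable_spectral_density.
- exact: spectral_density_ge0.
- apply: aeW => z /=; rewrite -[X in _ --> X]mulr1; apply: cvgMl_tmp.
  by apply: cvg_abel; exact: cvg_invS.
- move=> n; apply: le_trans (bessel_mass (e0 n) sa) _.
  by apply: le_Rintegral_mass => // x; exact: sqr_ge0.
- exact: cvg_cst.
Qed.

End EnergyIdentity.

(** * Continuous approximation in mean square *)

Section Plancherel.
Context {R : realType}.
Local Notation mu := (@lebesgue_measure R).
Local Notation mu2 := (mu \x mu)%E.
Implicit Types (a f g psi : R -> R) (e x y z : R).

(** Nearby points are handled by uniform continuity, distant ones by boundedness. The growth is
    quadratic because (x - y)^2 times the Poisson kernel is at most 2 e. *)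
Lemma quadratic_modulus psi (eta : R) : continuous psi -> 0 < eta ->
  exists2 K, 0 <= K & forall x y, `[-1, 1]%classic x -> `[-1, 1]%classic y ->
    (psi x - psi y) ^+ 2 <= eta + K * (x - y) ^+ 2.
Proof.
move=> cpsi eta0; pose s := Num.sqrt eta.
have s0 : 0 < s by rewrite sqrtr_gt0.
have [d d0 Hd] : exists2 d, 0 < d & forall x y, `[-1, 1]%classic x ->
    `|x - y| < d -> `|psi x - psi y| <= s.
  (* Compactness turns the radii that work near each point into one radius [d] for the whole
     interval. *)
  have /compact_near_coveringP cov := @segment_compact R (-1) 1.
  pose P (d x : R) := forall y, `|x - y| < d -> `|psi x - psi y| <= s.
  have := cov R (0^'+) P _ _; case.
    move=> x _; have := cpsi x => /cvgrPdist_lt /(_ (s / 2)) [|r /= r0 Hr].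
      by rewrite divr_gt0.
    exists (ball x (r / 2), [set d | d < r / 2]) => /=.
      split; first by apply: nbhsx_ballx; rewrite divr_gt0.
      by apply: nbhs_right_lt; rewrite divr_gt0.
    move=> [x' d] /= [bx dr] y xy.
    have h1 := Hr x' ltac:(by rewrite /ball /= in bx *; lra).
    have h2 : `|psi x - psi y| < s / 2.
      apply: Hr => /=; rewrite /ball /= in bx *.
      apply: le_lt_trans (ler_distD x' x y) _.
      by rewrite (splitr r) ltrD// (lt_trans xy dr).
    apply: le_trans (ler_distD (psi x) (psi x') (psi y)) _.
    by rewrite (splitr s) (distrC (psi x')) lerD// ltW.
  move=> r /= r0 Hr; exists (r / 2); first by rewrite divr_gt0.
  move=> x y xI; apply: (Hr (r / 2)) => //=; last by rewrite divr_gt0.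
  by rewrite sub0r normrN ger0_norm; lra.
have [M HM] : exists M, forall x, `[-1, 1]%classic x -> `|psi x| <= M.
  have cabs : {within `[-1, 1], continuous (fun x => `|psi x|)}.
    apply: continuous_subspaceT => x.
    by apply: continuous_comp; [exact: cpsi|exact: norm_continuous].
  have [|c _ Hc] := EVT_max _ cabs; first by lra.
  by exists `|psi c| => x xI; apply: Hc.
(* At distance [d] or more, K (x - y)^2 already exceeds (2 M)^2, the largest possible value of the
   left-hand side. *)
exists ((2 * M) ^+ 2 / d ^+ 2); first by rewrite divr_ge0 ?sqr_ge0.
move=> x y xI yI; have [xy|xy] := ltP `|x - y| d.
  rewrite -[leLHS]addr0 lerD//; last by rewrite mulr_ge0 ?divr_ge0 ?sqr_ge0.
  rewrite -real_normK ?num_real// -[leRHS](sqr_sqrtr (ltW eta0)).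
  by rewrite ler_sqr ?nnegrE ?(ltW s0)// Hd.
have H1 : (psi x - psi y) ^+ 2 <= (2 * M) ^+ 2.
  rewrite -real_normK ?num_real//.
  have h := ler_normB (psi x) (psi y); have := HM x xI; have := HM y yI => h1 h2.
  by rewrite ler_sqr ?nnegrE//; have := normr_ge0 (psi x); lra.
apply: le_trans H1 _; rewrite -[leLHS]add0r lerD ?(ltW eta0)//.
rewrite mulrAC ler_pdivlMr ?exprn_gt0// ler_wpM2l ?sqr_ge0//.
rewrite -[leRHS]real_normK ?num_real// ler_sqr ?nnegrE ?(ltW d0)//.
Qed.

(* Truncation at levels [-N] and [N], in a form that is visibly 1-Lipschitz. *)
Definition clamp (N t : R) : R := (`|t + N| - `|t - N|) / 2.

Lemma clamp_norm N t : 0 <= N -> `|clamp N t| <= N.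
Proof.
move=> N0; rewrite /clamp normrM (ger0_norm (x := 2^-1)) ?invr_ge0//.
rewrite ler_pdivrMr//; apply: le_trans (ler_dist_dist _ _) _.
rewrite (_ : t + N - (t - N) = N * 2); last by ring.
by rewrite ger0_norm// mulr_ge0.
Qed.

Lemma clamp_lipschitz N s t : `|clamp N s - clamp N t| <= `|s - t|.
Proof.
rewrite /clamp -mulrBl normrM (ger0_norm (x := 2^-1)) ?invr_ge0// ler_pdivrMr//.
rewrite (_ : _ - _ = (`|s + N| - `|t + N|) - (`|s - N| - `|t - N|)); last by ring.
apply: le_trans (ler_normB _ _) _.
have := ler_dist_dist (s + N) (t + N); have := ler_dist_dist (s - N) (t - N).
rewrite (_ : s + N - (t + N) = s - t); last by ring.
rewrite (_ : s - N - (t - N) = s - t); last by ring.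
lra.
Qed.

Lemma clamp_id N t : `|t| <= N -> clamp N t = t.
Proof.
rewrite ler_norml /clamp => /andP[h1 h2].
have h3 : 0 <= t + N by rewrite -lerBlDr sub0r.
have h4 : t - N <= 0 by rewrite subr_le0.
by rewrite (ger0_norm h3) (ler0_norm h4); field.
Qed.

Lemma clamp_sub_sqr N t : 0 <= N -> (t - clamp N t) ^+ 2 <= t ^+ 2.
Proof.
move=> N0; rewrite /clamp.
case: (ger0P (t + N)) => h1; case: (ger0P (t - N)) => h2; nra.
Qed.

Lemma continuous_clamp N : continuous (clamp N).
Proof.
move=> t; apply: cvgMr_tmp; apply: cvgB; apply: cvg_norm.
  by apply: cvgD; [exact: cvg_id|exact: cvg_cst].
by apply: cvgB; [exact: cvg_id|exact: cvg_cst].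
Qed.

Lemma clamp_cvg t : clamp n%:R t @[n --> \oo] --> t.
Proof.
apply: cvg_near_cst; near=> n; apply: clamp_id.
by near: n; exact: nbhs_infty_ger.
Unshelve. all: by end_near. Qed.

(** Continuous functions are dense in the mean. To pass to the mean square, [a] is truncated at a
    level [N] and its approximant is truncated too: between values in [-N, N] the square of a
    difference is at most 2 N times the difference. *)
Lemma continuous_dense_sq a (eta : R) : sq_integrable a -> 0 < eta ->
  exists2 psi, continuous psi & \int[mu]_x (chi x * (a x - psi x) ^+ 2) <= eta.
Proof.
move=> sa eta0; have ja := sq_integrable_intg sa; have [ma ja2 supp] := sa.
have mclamp N : measurable_fun setT (fun x => clamp N (a x)).
  apply: (measurableT_comp (f := clamp N)) => //.
  by apply: continuous_measurable_fun; exact: continuous_clamp.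
have [] := @dominated_Rint _ _ _ mu (fun n x => (a x - clamp n%:R (a x)) ^+ 2)
   (cst 0) (fun x => a x ^+ 2).
- by move=> n; apply: measurable_funX; exact: measurable_funB ma (mclamp _).
- exact: measurable_cst.
- apply: aeW => x /=.
  have c : a x - clamp n%:R (a x) @[n --> \oo] --> (0 : R).
    by rewrite -(subrr (a x)); apply: cvgB (@clamp_cvg (a x)); exact: cvg_cst.
  have c2 : (a x - clamp n%:R (a x)) * (a x - clamp n%:R (a x)) @[n --> \oo] --> (0 : R).
    by rewrite -[X in _ --> X](mulr0 0); exact: cvgM.
  by apply: cvg_trans c2; apply: near_eq_cvg; apply: nearW => n; rewrite expr2.
- exact: ja2.
- by apply: aeW => x n; rewrite ger0_norm ?sqr_ge0// clamp_sub_sqr.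
move=> jcl; rewrite [X in _ --> X](_ : _ = 0); last by rewrite Rintegral_cst// mul0r.
move=> /cvgrPdist_lt /(_ (eta / 4)) [|n _ /(_ n (leqnn n))].
  by rewrite divr_gt0.
rewrite /= sub0r normrN => /(le_lt_trans (ler_norm _)) Hn.
have N0 : 0 <= n%:R :> R by [].
set N : R := n%:R in N0 Hn.
have jclN : intg mu (fun x => (a x - clamp N (a x)) ^+ 2).
  apply: (@intg_le _ _ _ mu _ (fun x => a x ^+ 2)) => //.
    by apply: measurable_funX; exact: measurable_funB ma (mclamp _).
  by move=> x; rewrite ger0_norm ?sqr_ge0// clamp_sub_sqr.
have [| | |g_ [cg _ Hg]] := @approximation_continuous_integrable R `[-1, 1]%classic a.
- exact: measurable_itv.
- by rewrite /= lebesgue_measure_itv /= lte_fin; case: ifP => _; rewrite ?ltry// -EFinB ltry.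
- by apply: integrableS ja.
(* The truncation error, doubled, takes eta / 2; the rest is at most 4 N tol <= eta / 2. Using
   [N + 1] avoids a division by zero at level 0. *)
pose tol := eta / (8 * (N + 1)).
have D0 : 0 < 8 * (N + 1) by lra.
have tol0 : 0 < tol by rewrite divr_gt0.
have [m Hm] : exists m, (\int[mu]_x (chi x * `|a x - g_ m x|)%:E < tol%:E)%E.
  have /fine_cvgP[F1 /cvgrPdist_lt /(_ tol tol0) F2] := Hg.
  have [m [H1 H2]] := filter_ex (filterI F1 F2).
  exists m; move: H2; rewrite /= sub0r normrN => /(le_lt_trans (ler_norm _)).
  rewrite -lte_fin fineK//; apply: le_lt_trans.
  rewrite [leRHS]integral_mkcond le_eqVlt; apply/orP; left; apply/eqP.
  apply: eq_integral => x _; rewrite patchE; case: ifPn => [/set_mem xI|/negP xI].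
    by rewrite chi_in// mul1r.
  by rewrite chi_out ?mul0r// => /mem_set.
have mg : measurable_fun setT (g_ m) by exact: continuous_measurable_fun.
have jd : intg mu (fun x => chi x * `|a x - g_ m x|).
  apply: intg_lty; last exact: lt_trans Hm (ltry _).
    apply: measurable_funM; first exact: measurable_chi.
    by apply: measurableT_comp => //; apply: measurable_funB => //.
  by move=> x; rewrite mulr_ge0// chi_ge0.
exists (fun x => clamp N (g_ m x)).
  by move=> x; apply: continuous_comp; [exact: cg|exact: continuous_clamp].
have mpsi : measurable_fun setT (fun x => clamp N (g_ m x)).
  apply: (measurableT_comp (f := clamp N)) => //.
  by apply: continuous_measurable_fun; exact: continuous_clamp.
pose B x := 2 * (a x - clamp N (a x)) ^+ 2 + (4 * N) * (chi x * `|a x - g_ m x|).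
have jB : intg mu B by apply: intgD; apply: intgZ.
have le x : chi x * (a x - clamp N (g_ m x)) ^+ 2 <= B x.
  have h1 : (a x - clamp N (g_ m x)) ^+ 2 <= 2 * (a x - clamp N (a x)) ^+ 2 +
      4 * N * `|a x - g_ m x|.
    have l1 := clamp_lipschitz N (a x) (g_ m x).
    have b1 := clamp_norm (a x) N0; have b2 := clamp_norm (g_ m x) N0.
    have b3 := ler_normB (clamp N (a x)) (clamp N (g_ m x)).
    have h2 : (clamp N (a x) - clamp N (g_ m x)) ^+ 2 <= 2 * N * `|a x - g_ m x|.
      rewrite -real_normK ?num_real// expr2.
      by apply: ler_pM => //; lra.
    have := sqr_ge0 ((a x - clamp N (a x)) - (clamp N (a x) - clamp N (g_ m x))).
    move: h2; nra.
  have c0 := chi_ge0 x; have c1 := chi_le1 x.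
  have s0 := sqr_ge0 (a x - clamp N (a x)).
  apply: le_trans (ler_wpM2l c0 h1) _; rewrite /B mulrDr lerD//.
    by rewrite ler_piMl// mulr_ge0.
  by rewrite mulrCA.
have jl : intg mu (fun x => chi x * (a x - clamp N (g_ m x)) ^+ 2).
  apply: (@intg_le _ _ _ mu _ B) => //.
    apply: measurable_funM; first exact: measurable_chi.
    by apply: measurable_funX; apply: measurable_funB => //.
  by move=> x; rewrite ger0_norm// mulr_ge0 ?sqr_ge0 ?chi_ge0.
apply: le_trans (ler_Rint jl jB le) _.
rewrite /B RintD; [|exact: intgZ..].
rewrite !RintZ//.
have H5 : \int[mu]_x (chi x * `|a x - g_ m x|) <= tol.
  by rewrite -lee_fin -intg_EFin// ltW.
have H6 : (N + 1) * tol = eta / 8 by rewrite /tol; field; lra.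
have H7 : N * \int[mu]_x (chi x * `|a x - g_ m x|) <= N * tol by rewrite ler_wpM2l.
have H8 : N * tol <= eta / 8 by lra.
lra.
Qed.

End Plancherel.

(** * Hardy's inequality *)

Section Hardy.
Context {R : realType}.
Local Notation mu := (@lebesgue_measure R).
Local Notation mu2 := (mu \x mu)%E.
Implicit Types (a f g psi : R -> R) (e x y z : R).

Lemma sqrDB_le (u v w : R) : (u + v - w) ^+ 2 <= 2 * u ^+ 2 + 4 * v ^+ 2 + 4 * w ^+ 2.
Proof. by have := sqr_ge0 (u - (v - w)); have := sqr_ge0 (v + w); nra. Qed.

(** Applied with [u] an increment of the continuous approximant, [v] and [w] the approximation
    errors at the two points, [d] the squared distance and [L] the Poisson kernel. *)
Lemma oscillation_pointwise (eta K e d L u v w : R) : 0 <= K -> 0 <= L ->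
  u ^+ 2 <= eta + K * d -> d * L <= 2 * e ->
  (u + v - w) ^+ 2 * L <=
  2 * eta * L + 4 * K * e + 4 * (v ^+ 2 * L) + 4 * (w ^+ 2 * L).
Proof.
move=> K0 L0 hu hL.
apply: le_trans (ler_wpM2r L0 (sqrDB_le u v w)) _.
have := ler_wpM2r L0 hu; have := ler_wpM2l K0 hL; lra.
Qed.

(** The oscillation tends to 0 with [e], possibly at no definite rate: [C] depends on [eta] through
    the continuous approximant and its modulus. *)
Lemma oscillation_le_affine a (eta : R) : sq_integrable a -> 0 < eta ->
  exists C, forall e, 0 < e -> oscillation e a <= eta + C * e.
Proof.
move=> sa eta0; have [ma ja2 supp] := sa.
have pi0 : 0 < pi :> R by exact: pi_gt0.
(* As the interval has length 2 and the kernel has mass at most 2 pi, eta / (32 pi) for the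
   approximation error and eta / (16 pi) for the modulus cost eta / 2 each in the final bound. *)
have d0 : 0 < eta / (32 * pi) by rewrite divr_gt0// mulr_gt0.
have [psi cpsi Hpsi] := continuous_dense_sq sa d0.
have s0 : 0 < eta / (16 * pi) by rewrite divr_gt0// mulr_gt0.
have [K K0 HK] := quadratic_modulus cpsi s0.
(* The pointwise bound contains 4 K e, and the square has area 4. *)
exists (16 * K) => e e0.
pose g x := chi x * (a x - psi x) ^+ 2.
have mpsi : measurable_fun setT psi by exact: continuous_measurable_fun.
have g0 x : 0 <= g x by rewrite mulr_ge0 ?chi_ge0 ?sqr_ge0.
have jg : intg mu g.
  have [M HM] : exists M, forall x, `[-1, 1]%classic x -> `|psi x| <= M.
    have cabs : {within `[-1, 1], continuous (fun x => `|psi x|)}.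
      apply: continuous_subspaceT => x.
      by apply: continuous_comp; [exact: cpsi|exact: norm_continuous].
    have [|c _ Hc] := EVT_max _ cabs; first by lra.
    by exists `|psi c| => x xI; apply: Hc.
  apply: (@intg_le _ _ _ mu _ (fun x => 2 * a x ^+ 2 + (2 * M ^+ 2) * chi x)).
  - apply: measurable_funM; first exact: measurable_chi.
    by apply: measurable_funX; exact: measurable_funB ma mpsi.
  - move=> x; rewrite ger0_norm// /g; have [xI|xI] := pselect (`[-1, 1]%classic x).
      rewrite chi_in// mul1r mulr1.
      have : psi x ^+ 2 <= M ^+ 2.
        rewrite -real_normK ?num_real// ler_sqr ?nnegrE ?HM//.
        exact: le_trans (normr_ge0 _) (HM x xI).
      by have := sqr_ge0 (a x + psi x); nra.
    by rewrite chi_out// mul0r mulr0 addr0 mulr_ge0 ?sqr_ge0.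
  - by apply: intgD; apply: intgZ => //; exact: intg_chi.
have jc := @intg_chi R.
have [J1 _ _] := energy_identity e0 sa.
have [M1 K1 _] := Rintegral_poisson_chi e0 jc.
have [M2 K2 K3] := Rintegral_poisson_chi e0 jg.
have T1 := intg_poisson_tensor e0 jc jc.
have T2 := intg_poisson_tensor e0 jg jc.
have T3 := intg_poisson_tensor e0 jc jg.
have b1 (p : R * R) : `|cst (1 : R) p| <= 1 by rewrite normr1.
have m1 : measurable_fun setT (cst (1 : R) : R * R -> R) by exact: measurable_cst.
have T4 := intg_tensor jc jc m1 b1.
have [_ _ K4 _] := double_Rintegral jc jc m1 b1.
have Ichi : \int[mu]_x chi x = 2 :> R by rewrite /Rintegral integral_chi.
have K4' : \int[mu2]_p (chi p.1 * chi p.2 * cst 1 p) = 4 :> R.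
  rewrite K4 (_ : (fun x => _) = (fun x => 2 * chi x)).
    by rewrite RintZ// Ichi; ring.
  apply/funext => x; rewrite mulrC; congr (_ * _).
  by under eq_Rintegral do rewrite mulr1.
pose B (p : R * R) := (2 * (eta / (16 * pi))) * (chi p.1 * chi p.2 * poisson e (p.1 - p.2))
  + (4 * K * e) * (chi p.1 * chi p.2 * cst 1 p)
  + 4 * (g p.1 * chi p.2 * poisson e (p.1 - p.2))
  + 4 * (chi p.1 * g p.2 * poisson e (p.1 - p.2)).
have jB1 := intgD (intgZ (2 * (eta / (16 * pi))) T1) (intgZ (4 * K * e) T4).
have jB2 := intgD jB1 (intgZ 4 T2).
have jB : intg mu2 B := intgD jB2 (intgZ 4 T3).
have IB : \int[mu2]_p B p = 2 * (eta / (16 * pi)) * \int[mu]_x (chi x * mass e x)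
   + (4 * K * e) * 4 + 8 * \int[mu]_x (g x * mass e x).
  rewrite /B (RintD jB2 (intgZ 4 T3)) (RintD jB1 (intgZ 4 T2)).
  rewrite (RintD (intgZ (2 * (eta / (16 * pi))) T1) (intgZ (4 * K * e) T4)).
  rewrite (RintZ _ T1) (RintZ _ T4) (RintZ _ T2) (RintZ _ T3) K1 K2 K3 K4'.
  rewrite -addrA; congr (_ + _); rewrite -mulrDl; congr (_ * _); ring.
have L1 := le_Rintegral_mass e0 chi_ge0 jc.
have L2 := le_Rintegral_mass e0 g0 jg.
rewrite Ichi in L1.
have pt (p : R * R) : chi p.1 * chi p.2 * ((a p.1 - a p.2) ^+ 2 * poisson e (p.1 - p.2)) <= B p.
  case: p => x y; rewrite /B /=.
  have L0 := poisson_ge0 (x - y) e0.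
  have [xI|xI] := pselect (`[-1, 1]%classic x); last by rewrite chi_out// !mul0r /g chi_out// !mul0r !mulr0 !addr0.
  have [yI|yI] := pselect (`[-1, 1]%classic y); last by rewrite /g (chi_out yI) !(mulr0, mul0r, addr0).
  rewrite /g !chi_in// !mul1r !mulr1.
  have Lq : (x - y) ^+ 2 * poisson e (x - y) <= 2 * e.
    rewrite /poisson mulrA ler_pdivrMr ?poisson_den_gt0//.
    by rewrite mulrC ler_wpM2l ?mulr_ge0 ?(ltW e0)// lerDr sqr_ge0.
  have := oscillation_pointwise (a x - psi x) (a y - psi y) K0 L0 (HK x y xI yI) Lq.
  by rewrite (_ : _ + _ - _ = a x - a y); [|ring].
rewrite /oscillation; apply: le_trans (ler_Rint J1 jB pt) _; rewrite IB.
have pin : pi != 0 :> R by exact: lt0r_neq0.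
have E1 : 2 * (eta / (16 * pi)) * \int[mu]_x (chi x * mass e x) <= eta / 2.
  have -> : eta / 2 = 2 * (eta / (16 * pi)) * (2 * pi * 2).
    by move: (pi : R) pin => p pin; field.
  apply: ler_wpM2l L1; apply: mulr_ge0 => //; exact: ltW.
have E2 : 8 * \int[mu]_x (g x * mass e x) <= eta / 2.
  have -> : eta / 2 = 8 * (2 * pi * (eta / (32 * pi))).
    by move: (pi : R) pin => p pin; field.
  apply: ler_wpM2l => //; apply: le_trans L2 _; apply: ler_wpM2l => //.
  by apply: mulr_ge0 => //; exact: ltW.
apply: (@le_trans _ _ (eta / 2 + 4 * K * e * 4 + eta / 2)).
  by apply: lerD E2; apply: lerD E1 _.
by rewrite le_eqVlt; apply/orP; left; apply/eqP; field.
Qed.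

Lemma ae_neq (c : R) : {ae mu, forall x, x != c}.
Proof.
exists [set c]; split; [exact: measurable_set1|exact: lebesgue_measure_set1|].
by move=> x /= /negP; rewrite negbK => /eqP.
Qed.

(** In the energy identity the mass term converges to the left-hand side by dominated convergence,
    the weighted spectral integral is at most the unweighted one, and the oscillation is eventually
    below any [eta]. *)
Lemma plancherel_ge a : sq_integrable a ->
  2 * pi * \int[mu]_x (a x ^+ 2) <= \int[mu]_z spectral_density a z.
Proof.
move=> sa; have [ma ja2 supp] := sa; have [jG _] := bessel sa.
have e0 n : 0 < (n.+1%:R : R)^-1 by rewrite invr_gt0.
have pi0 : 0 <= 2 * pi :> R by apply: mulr_ge0 => //; exact: pi_ge0.
have [_ H] : intg mu (fun x => 2 * pi * a x ^+ 2) /\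
  \int[mu]_x (a x ^+ 2 * mass n.+1%:R^-1 x) @[n --> \oo] -->
    \int[mu]_x (2 * pi * a x ^+ 2).
  apply: (@dominated_Rint _ _ _ mu _ _ (fun x => 2 * pi * a x ^+ 2)).
  - by move=> n; apply: intg_measurable; exact: intg_mul_mass (e0 n) ja2.
  - exact: intg_measurable (intgZ (2 * pi) ja2).
  (* At the endpoints only half of the mass stays, so there the limit is pi instead of 2 pi. *)
  - apply: ae_mono (ae_and (ae_neq 1) (ae_neq (-1))) => x [x1 x2].
    have [xI|xI] := pselect (`[-1, 1]%classic x); last first.
      by rewrite supp// expr0n mulr0; under eq_fun do rewrite mul0r; exact: cvg_cst.
    rewrite mulrC; apply: cvgMl_tmp; apply: cvg_mass => //; first exact: cvg_invS.
    move: xI; rewrite /= in_itv /= !le_eqVlt => /andP[].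
    by rewrite (eq_sym _ x) (negbTE x1) (negbTE x2) /= => -> ->.
  - exact: intgZ.
  - apply: aeW => x n; rewrite normrM ger0_norm ?sqr_ge0// mulrC ler_wpM2r ?sqr_ge0//.
    by rewrite ger0_norm ?mass_ge0 ?mass_le.
rewrite -RintZ//; apply/ler_addgt0Pr => eta eta0.
have [C HC] := oscillation_le_affine sa eta0.
have c2 : C * n.+1%:R^-1 @[n --> \oo] --> 0.
  by rewrite -[X in _ --> X](mulr0 C); apply: cvgMl_tmp; exact: cvg_invS.
have c3 : \int[mu]_z spectral_density a z + eta + C * n.+1%:R^-1 @[n --> \oo] -->
    \int[mu]_z spectral_density a z + eta.
  by rewrite -[X in _ --> X]addr0; apply: cvgD c2; exact: cvg_cst.
apply: (ler_cvg_to H c3); apply: nearW => n.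
have [_ jw E] := energy_identity (e0 n) sa.
have o := HC _ (e0 n); have o0 := oscillation_ge0 a (e0 n).
have L : \int[mu]_z (spectral_density a z * abel n.+1%:R^-1 z) <=
    \int[mu]_z spectral_density a z.
  apply: ler_Rint => // z; rewrite ler_piMr ?spectral_density_ge0//.
  exact: abel_le1.
rewrite E in L; apply: (@le_trans _ _ (\int[mu]_z spectral_density a z + oscillation n.+1%:R^-1 a / 2)).
  by rewrite -lerBlDr.
rewrite -addrA lerD2l; apply: le_trans o.
by rewrite ler_pdivrMr// ler_peMr// ler1n.
Qed.

Definition energy a : R := \int[mu]_z (`|z| * spectral_density a z).

(** Two inequalities in the right directions suffice: [plancherel_ge] for the unweighted integral
    and [bessel_mass] for the weighted one. In frequency, (1 - exp (- e |z|)) / e <= |z|; in space,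
    Fatou's lemma yields the limit weight. *)
Lemma hardy a : sq_integrable a -> intg mu (fun z => `|z| * spectral_density a z) ->
  intg mu (fun x => a x ^+ 2 / (1 - x ^+ 2)) /\
  4 * \int[mu]_x (a x ^+ 2 / (1 - x ^+ 2)) <= energy a.
Proof.
move=> sa jE; have [ma ja2 supp] := sa; have ja := sq_integrable_intg sa.
have [jG _] := bessel sa; have P := plancherel_ge sa.
pose w e x : R := (1 - x) / (e ^+ 2 + (1 - x) ^+ 2) + (1 + x) / (e ^+ 2 + (1 + x) ^+ 2).
have inI x : `[-1, 1]%classic x -> 0 <= 1 - x /\ 0 <= 1 + x.
  by rewrite /= in_itv /= => /andP[? ?]; split; lra.
have w0 e x : `[-1, 1]%classic x -> 0 <= w e x.
  move=> /inI[x1 x2]; apply: addr_ge0; apply: divr_ge0 => //; apply: addr_ge0; exact: sqr_ge0.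
have mw e : 0 < e -> measurable_fun setT (w e).
  move=> e0; apply: continuous_measurable_fun => x.
  have D1 := poisson_den_gt0 (1 - x) e0; have D2 := poisson_den_gt0 (1 + x) e0.
  have c1 : {for x, continuous (fun x => 1 - x : R)}.
    by apply: cvgB; [exact: cvg_cst|exact: cvg_id].
  have c2 : {for x, continuous (fun x => 1 + x : R)}.
    by apply: cvgD; [exact: cvg_cst|exact: cvg_id].
  have q (h : R -> R) : {for x, continuous h} -> 0 < e ^+ 2 + h x ^+ 2 ->
      {for x, continuous (fun x => h x / (e ^+ 2 + h x ^+ 2))}.
    move=> ch Dh; apply: cvgM => //; apply: cvgV; first exact: lt0r_neq0.
    apply: cvgD; first exact: cvg_cst.
    exact: (cvg_comp _ _ ch (@exprn_continuous R 2 _)).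
  by apply: cvgD; apply: q.
have bound e : 0 < e ->
  intg mu (fun x => a x ^+ 2 * (2 * w e x)) /\ \int[mu]_x (a x ^+ 2 * (2 * w e x)) <= energy a.
  move=> e0.
  have jm := intg_mul_mass e0 ja2.
  have jd : intg mu (fun x => a x ^+ 2 * (2 * pi - mass e x)).
    rewrite (_ : (fun x => _) = (fun x => (2 * pi) * a x ^+ 2 - a x ^+ 2 * mass e x)).
      exact: intgB (intgZ _ ja2) jm.
    by apply/funext => x; ring.
  have le x : a x ^+ 2 * (2 * w e x) <= e^-1 * (a x ^+ 2 * (2 * pi - mass e x)).
    have [xI|xI] := pselect (`[-1, 1]%classic x); last by rewrite supp// expr0n !mul0r mulr0.
    rewrite [leRHS]mulrCA ler_wpM2l ?sqr_ge0// [leRHS]mulrC ler_pdivlMr//.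
    exact: mass_defect.
  have jw : intg mu (fun x => a x ^+ 2 * (2 * w e x)).
    apply: (@intg_le _ _ _ mu _ (fun x => e^-1 * (a x ^+ 2 * (2 * pi - mass e x)))).
    - apply: measurable_funM; first exact: measurable_funX.
      by apply: measurable_funM; [exact: measurable_cst|exact: mw].
    - move=> x; rewrite ger0_norm//.
      have [xI|xI] := pselect (`[-1, 1]%classic x); last by rewrite supp// expr0n mul0r.
      by apply: mulr_ge0; [exact: sqr_ge0|apply: mulr_ge0 => //; exact: w0].
    - exact: intgZ.
  split => //; apply: le_trans (ler_Rint jw (intgZ _ jd) le) _.
  have [_ jGw _] := energy_identity e0 sa.
  have -> : \int[mu]_x (e^-1 * (a x ^+ 2 * (2 * pi - mass e x))) =
     e^-1 * (2 * pi * \int[mu]_x (a x ^+ 2) - \int[mu]_x (a x ^+ 2 * mass e x)).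
    rewrite RintZ//; congr (_ * _); rewrite -RintZ// -RintB//; last exact: intgZ.
    by apply: eq_Rintegral => x _; ring.
  rewrite mulrC ler_pdivrMr//.
  apply: (@le_trans _ _ (\int[mu]_z spectral_density a z -
    \int[mu]_z (spectral_density a z * abel e z))).
    by rewrite lerB// bessel_mass.
  rewrite -RintB// /energy mulrC -RintZ//; apply: ler_Rint => [||z].
  - exact: intgB.
  - exact: intgZ.
  - rewrite -[X in X - _]mulr1 -mulrBr mulrA mulrC ler_wpM2r ?spectral_density_ge0//.
    by rewrite /abel lerBlDr -lerBlDl; have := expR_ge1Dx (- (e * `|z|)); lra.
have e0 n : 0 < (n.+1%:R : R)^-1 by rewrite invr_gt0.
have mV : measurable_fun setT (fun x => a x ^+ 2 / (1 - x ^+ 2)).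
  (* On [-1, 1] the base is nonnegative and the power is the inverse, both being 0 at the endpoints;
     elsewhere [a] vanishes. *)
  rewrite (_ : (fun x => _) = (fun x => a x ^+ 2 * powR (1 - x ^+ 2) (-1))).
    apply: measurable_funM; first exact: measurable_funX.
    apply: (measurableT_comp (measurable_powR (-1))).
    by apply: measurable_funB; [exact: measurable_cst|exact: measurable_funX].
  apply/funext => x; have [xI|xI] := pselect (`[-1, 1]%classic x); last by rewrite supp// expr0n !mul0r.
  by have [? ?] := inI _ xI; rewrite powR_inv1//; nra.
have [] := @fatou_Rint _ _ _ mu (fun n x => a x ^+ 2 * (2 * w n.+1%:R^-1 x))
   (fun x => 4 * (a x ^+ 2 / (1 - x ^+ 2))) (fun=> energy a) (energy a).
- by move=> n; have [] := bound _ (e0 n).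
- move=> n x; have [xI|xI] := pselect (`[-1, 1]%classic x); last by rewrite supp// expr0n mul0r.
  by apply: mulr_ge0; [exact: sqr_ge0|apply: mulr_ge0 => //; exact: w0].
- by apply: measurable_funM; [exact: measurable_cst|exact: mV].
- move=> x; have [xI|xI] := pselect (`[-1, 1]%classic x); last by rewrite supp// expr0n mul0r mulr0.
  have [? ?] := inI _ xI.
  apply: mulr_ge0 => //; apply: mulr_ge0; first exact: sqr_ge0.
  by rewrite invr_ge0; nra.
- apply: ae_mono (ae_and (ae_neq 1) (ae_neq (-1))) => x [x1 x2].
  have d1 : 1 - x != 0 by rewrite subr_eq0 eq_sym.
  have d2 : 1 + x != 0 by rewrite addrC addr_eq0.
  (* The limit is rewritten as the value of the approximating expression at e = 0. *)
  have -> : 4 * (a x ^+ 2 / (1 - x ^+ 2)) =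
      a x ^+ 2 * (2 * ((1 - x) / (0 ^+ 2 + (1 - x) ^+ 2) + (1 + x) / (0 ^+ 2 + (1 + x) ^+ 2))).
    rewrite expr0n /= !add0r; field; rewrite d1 d2 /=.
    rewrite (_ : 1 - x ^+ 2 = (1 - x) * (1 + x)); last by ring.
    by rewrite mulf_neq0.
  have c (s : R) : s != 0 -> s / (n.+1%:R^-1 ^+ 2 + s ^+ 2) @[n --> \oo] --> s / (0 ^+ 2 + s ^+ 2).
    move=> s0; apply: cvgMl_tmp; apply: cvgV.
      by rewrite expr0n add0r sqrf_eq0.
    apply: cvgD; last exact: cvg_cst.
    exact: (cvg_comp _ (fun t : R => t ^+ 2) cvg_invS (@exprn_continuous R 2 0)).
  by apply: cvgMl_tmp; apply: cvgMl_tmp; apply: cvgD; exact: c.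
- by move=> n; have [] := bound _ (e0 n).
- exact: cvg_cst.
move=> j4 H.
have j : intg mu (fun x => a x ^+ 2 / (1 - x ^+ 2)).
  move: (intgZ 4^-1 j4); congr (intg _ _); apply/funext => x.
  by rewrite mulrA mulVf ?mul1r.
by split => //; rewrite -RintZ.
Qed.
End Hardy.

(** * The real quadratic form *)

Section RealForm.
Context {R : realType}.
Local Notation mu := (@lebesgue_measure R).
Implicit Types (a b g : R -> R) (z x : R).

(** The polarization of [spectral_density]: the real part of [fourier a z * conjc (fourier b z)] for
    real-valued [a] and [b]. *)
Definition spectral_form a b z : R :=
  cos_transform a z * cos_transform b z + sin_transform a z * sin_transform b z.

Lemma cos_transformD (c : R) a b z : intg mu a -> intg mu b ->
  cos_transform (fun x => a x + c * b x) z = cos_transform a z + c * cos_transform b z.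
Proof.
move=> ja jb; rewrite /cos_transform -RintZ; last exact: intg_mul_cos.
rewrite -RintD; [|exact: intg_mul_cos|exact/intgZ/intg_mul_cos].
by apply: eq_Rintegral => x _; ring.
Qed.

Lemma sin_transformD (c : R) a b z : intg mu a -> intg mu b ->
  sin_transform (fun x => a x + c * b x) z = sin_transform a z + c * sin_transform b z.
Proof.
move=> ja jb; rewrite /sin_transform -RintZ; last exact: intg_mul_sin.
rewrite -RintD; [|exact: intg_mul_sin|exact/intgZ/intg_mul_sin].
by apply: eq_Rintegral => x _; ring.
Qed.

Lemma spectral_formDl (c : R) a b g z : intg mu a -> intg mu b ->
  spectral_form (fun x => a x + c * b x) g z = spectral_form a g z + c * spectral_form b g z.
Proof.
by move=> ja jb; rewrite /spectral_form cos_transformD// sin_transformD//; ring.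
Qed.

Lemma spectral_form_le a b z :
  `|spectral_form a b z| <= spectral_density a z + spectral_density b z.
Proof.
rewrite /spectral_form /spectral_density.
move: (cos_transform a z) (cos_transform b z) (sin_transform a z) (sin_transform b z) => p q r s.
have := sqr_ge0 (p + q); have := sqr_ge0 (p - q); have := sqr_ge0 (r + s); have := sqr_ge0 (r - s).
have := sqr_ge0 p; have := sqr_ge0 q; have := sqr_ge0 r; have := sqr_ge0 s.
by rewrite ler_norml => ????????; apply/andP; split; nra.
Qed.

Lemma measurable_spectral_form a b : intg mu a -> intg mu b ->
  measurable_fun setT (spectral_form a b).
Proof.
move=> ja jb; exact: (measurable_funD
  (measurable_funM (measurable_cos_transform ja) (measurable_cos_transform jb))
  (measurable_funM (measurable_sin_transform ja) (measurable_sin_transform jb))).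
Qed.

Lemma measurable_absR : measurable_fun setT (fun z : R => `|z|).
Proof. by apply: continuous_measurable_fun; exact: norm_continuous. Qed.

Definition finite_energy a :=
  sq_integrable a /\ intg mu (fun z => `|z| * spectral_density a z).

Lemma finite_energyD (c : R) a b : finite_energy a -> finite_energy b ->
  finite_energy (fun x => a x + c * b x).
Proof.
move=> [sa ea] [sb eb]; have sab := sq_integrableD c sa sb; split => //.
have ja := sq_integrable_intg sa; have jb := sq_integrable_intg sb.
apply: (@intg_le _ _ _ mu _ (fun z => 2 * (`|z| * spectral_density a z) +
    (2 * c ^+ 2) * (`|z| * spectral_density b z))).
- apply: measurable_funM; first exact: measurable_absR.
  by apply: measurable_spectral_density; exact: sq_integrable_intg.
- move=> z; rewrite ger0_norm ?mulr_ge0 ?spectral_density_ge0//.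
  rewrite [leRHS](_ : _ = `|z| * (2 * spectral_density a z + 2 * c ^+ 2 * spectral_density b z)); last by ring.
  rewrite ler_wpM2l// /spectral_density cos_transformD// sin_transformD//.
  move: (cos_transform a z) (cos_transform b z) (sin_transform a z) (sin_transform b z) => p q r s.
  by have := sqr_ge0 (p - c * q); have := sqr_ge0 (r - c * s); lra.
- by apply: intgD; apply: intgZ.
Qed.

Lemma finite_energyZ (c : R) a : finite_energy a -> finite_energy (fun x => c * a x).
Proof.
move=> fa; have := finite_energyD (c - 1) fa fa; congr finite_energy.
by apply/funext => x; ring.
Qed.

Lemma intg_spectral_form a b : finite_energy a -> finite_energy b ->
  intg mu (fun z => `|z| * spectral_form a b z).
Proof.
move=> [sa ea] [sb eb].
have ja := sq_integrable_intg sa; have jb := sq_integrable_intg sb.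
apply: (@intg_le _ _ _ mu _ (fun z => `|z| * spectral_density a z + `|z| * spectral_density b z)).
- apply: measurable_funM; first exact: measurable_absR.
  exact: measurable_spectral_form.
- by move=> z; rewrite normrM normr_id -mulrDr ler_wpM2l// spectral_form_le.
- exact: intgD.
Qed.

(** The bound is the one that Hardy's inequality can absorb. The endpoints are exempt because there
    [K / (1 - x ^+ 2)] is 0 by convention. *)
Definition hardy_potential (W : R -> R) := exists K, [/\ measurable_fun setT W,
  forall x, 0 <= W x & forall x, `[-1, 1]%classic x -> (1 - x ^+ 2) != 0 ->
   W x <= K / (1 - x ^+ 2)].

Variable W : R -> R.
Hypothesis hW : hardy_potential W.

Let mW : measurable_fun setT W. Proof. by case: hW => K []. Qed.
Let W0 x : 0 <= W x. Proof. by case: hW => K []. Qed.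

Lemma intg_potential_sqr a : finite_energy a -> intg mu (fun x => W x * a x ^+ 2).
Proof.
move=> [sa ea]; have [ma ja2 supp] := sa.
have [K [_ _ WK]] := hW; have [jh _] := hardy sa ea.
pose b x := K * (a x ^+ 2 / (1 - x ^+ 2)).
have jb : intg mu b by exact: intgZ.
have m : measurable_fun setT (fun x => W x * a x ^+ 2).
  by apply: measurable_funM => //; exact: measurable_funX.
(* The domination by [b] may fail at the endpoints; the minimum is dominated everywhere and differs
   from the integrand only there. *)
pose f x := Num.min (W x * a x ^+ 2) (`|b x|).
have mf : measurable_fun setT f.
  apply: measurable_minr => //; apply: measurableT_comp => //.
  exact: intg_measurable jb.
have jf : intg mu f.
  apply: (@intg_le _ _ _ mu _ (fun x => `|b x|)) => //; last exact: intg_norm.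
  move=> x; rewrite ger0_norm ?ge_min ?lexx ?orbT//.
  by rewrite le_min mulr_ge0 ?sqr_ge0//=.
apply: ae_intg jf => //.
apply: ae_mono (ae_and (ae_neq 1) (ae_neq (-1))) => x [x1 x2].
apply/min_idPl; have [xI|xI] := pselect (`[-1, 1]%classic x); last first.
  by rewrite supp// expr0n mulr0.
have d : 1 - x ^+ 2 != 0.
  by rewrite subr_eq0 eq_sym sqrf_eq1 negb_or x1 x2.
apply: le_trans (ler_norm _); rewrite /b [leRHS]mulrA [leRHS]mulrAC.
by rewrite ler_wpM2r ?sqr_ge0// WK.
Qed.

Lemma intg_potential a b : finite_energy a -> finite_energy b ->
  intg mu (fun x => W x * (a x * b x)).
Proof.
move=> fa fb; have [[ma _ _] _] := fa; have [[mb _ _] _] := fb.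
apply: (@intg_le _ _ _ mu _ (fun x => W x * a x ^+ 2 + W x * b x ^+ 2)).
- by apply: measurable_funM => //; exact: measurable_funM.
- move=> x; rewrite normrM ger0_norm// -mulrDr ler_wpM2l// ler_norml.
  by apply/andP; split; nra.
- by apply: intgD; exact: intg_potential_sqr.
Qed.

Definition real_form a b : R :=
  \int[mu]_x (W x * (a x * b x)) + (4 * pi)^-1 * \int[mu]_z (`|z| * spectral_form a b z).

Definition real_quad a : R := real_form a a.

Lemma real_formDl (c : R) a b g : finite_energy a -> finite_energy b -> finite_energy g ->
  real_form (fun x => a x + c * b x) g = real_form a g + c * real_form b g.
Proof.
move=> fa fb fg; rewrite /real_form.
have ja := sq_integrable_intg fa.1; have jb := sq_integrable_intg fb.1.
have E1 : \int[mu]_x (W x * ((a x + c * b x) * g x)) =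
   \int[mu]_x (W x * (a x * g x)) + c * \int[mu]_x (W x * (b x * g x)).
  rewrite -RintZ ?intg_potential// -RintD ?intgZ ?intg_potential//.
  by apply: eq_Rintegral => x _; ring.
have E2 : \int[mu]_z (`|z| * spectral_form (fun x => a x + c * b x) g z) =
   \int[mu]_z (`|z| * spectral_form a g z) + c * \int[mu]_z (`|z| * spectral_form b g z).
  rewrite -RintZ ?intg_spectral_form// -RintD ?intgZ ?intg_spectral_form//.
  by apply: eq_Rintegral => z _; rewrite spectral_formDl//; ring.
rewrite E1 E2.
by move: (Rintegral _ _ _) (Rintegral _ _ _) (Rintegral _ _ _) (Rintegral _ _ _) => p q r s; ring.
Qed.

Lemma real_formC a b : real_form a b = real_form b a.
Proof.
rewrite /real_form; congr (_ + _ * _); apply: eq_Rintegral => x _.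
  by rewrite [a x * _]mulrC.
by congr (_ * (_ + _)); exact: mulrC.
Qed.

Lemma real_quadE a : real_quad a = \int[mu]_x (W x * a x ^+ 2) + (4 * pi)^-1 * energy a.
Proof.
by rewrite /real_quad /real_form /energy; congr (_ + _ * _).
Qed.

Lemma energy_ge0 a : 0 <= energy a.
Proof. by apply: Rintegral_ge0 => z _; rewrite mulr_ge0 ?spectral_density_ge0. Qed.

Lemma energy_le_quad a : energy a <= 4 * pi * real_quad a.
Proof.
have pi0 : 0 < 4 * pi :> R by rewrite mulr_gt0// pi_gt0.
rewrite -ler_pdivrMl// real_quadE lerDr; apply: Rintegral_ge0 => x _.
by rewrite mulr_ge0 ?sqr_ge0.
Qed.

Lemma real_quad_ge0 a : 0 <= real_quad a.
Proof.
have pi0 : 0 < 4 * pi :> R by rewrite mulr_gt0// pi_gt0.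
by rewrite -(pmulr_rge0 _ pi0); apply: le_trans (energy_le_quad a); exact: energy_ge0.
Qed.

Lemma sq_norm_le_energy a : finite_energy a ->
  4 * \int[mu]_x (a x ^+ 2) <= energy a.
Proof.
move=> [sa ea]; have [ma ja2 supp] := sa; have [jh h] := hardy sa ea.
apply: le_trans h; rewrite ler_wpM2l//; apply: ae_ler_Rint => //.
apply: ae_mono (ae_and (ae_neq 1) (ae_neq (-1))) => x [x1 x2].
have [xI|xI] := pselect (`[-1, 1]%classic x); last by rewrite supp// expr0n mul0r.
have d : 1 - x ^+ 2 != 0 by rewrite subr_eq0 eq_sym sqrf_eq1 negb_or x1 x2.
move: xI; rewrite /= in_itv /= => /andP[h1 h2].
have d0 : 0 < 1 - x ^+ 2 by rewrite lt_neqAle eq_sym d /=; nra.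
by rewrite ler_pdivlMr// ler_piMr ?sqr_ge0//; have := sqr_ge0 x; lra.
Qed.

(* Hardy's inequality even gives the constant [pi + 2]. *)
Lemma sobolev_le_quad a : finite_energy a ->
  intg mu (fun z => Num.sqrt (1 + z ^+ 2) * spectral_density a z) /\
  (2 * pi)^-1 * \int[mu]_z (Num.sqrt (1 + z ^+ 2) * spectral_density a z)
    <= (2 * pi + 2) * real_quad a.
Proof.
move=> fa; have [sa ea] := fa; have [jG G] := bessel sa.
have le z : Num.sqrt (1 + z ^+ 2) * spectral_density a z <=
    spectral_density a z + `|z| * spectral_density a z.
  rewrite -[X in _ <= X + _]mul1r -mulrDl ler_wpM2r ?spectral_density_ge0//.
  have z0 : 0 <= 1 + `|z| by rewrite addr_ge0.
  rewrite -(ger0_norm z0) -sqrtr_sqr ler_wsqrtr// -[z ^+ 2]real_normK ?num_real//.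
  by have := normr_ge0 z; nra.
have jj := intgD jG ea.
have j : intg mu (fun z => Num.sqrt (1 + z ^+ 2) * spectral_density a z).
  apply: (@intg_le _ _ _ mu _ _ _ _ jj).
    apply: measurable_funM; last first.
      by apply: measurable_spectral_density; exact: sq_integrable_intg.
    apply: (measurableT_comp (f := @Num.sqrt R)).
      by apply: continuous_measurable_fun; exact: sqrt_continuous.
    by apply: measurable_funD; [exact: measurable_cst|exact: measurable_funX].
  by move=> z; rewrite ger0_norm// mulr_ge0 ?sqrtr_ge0 ?spectral_density_ge0.
split => //.
have pi0 : 0 < pi :> R by exact: pi_gt0.
rewrite ler_pdivrMl ?mulr_gt0//.
apply: le_trans (ler_Rint j jj le) _; rewrite RintD//.
have h1 := sq_norm_le_energy fa; have h2 := energy_le_quad a.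
have h3 : 2 * pi * \int[mu]_x (a x ^+ 2) <= 2 * pi * (energy a / 4).
  by apply: ler_wpM2l; [rewrite mulr_ge0// ltW|rewrite ler_pdivlMr// mulrC].
(* The factor is (2 pi / 4 + 1) 4 pi = 2 pi (pi + 2), which after division by 2 pi leaves pi + 2. *)
have h4 : (2 * pi / 4 + 1) * energy a <= (2 * pi / 4 + 1) * (4 * pi * real_quad a).
  by apply: ler_wpM2l => //; rewrite addr_ge0// divr_ge0// mulr_ge0// ltW.
have h5 := real_quad_ge0 a.
move: G h1 h2 h3 h4 h5; rewrite -/(energy a).
move: (energy a) (real_quad a) (\int[mu]_z spectral_density a z) (\int[mu]_x (a x ^+ 2)) (pi : R) pi0.
clear => E Q G A p p0 hG h1 h2 h3 h4 h5.
have : 0 <= p * Q by rewrite mulr_ge0// ltW.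
have : 0 <= p * p * Q by rewrite !mulr_ge0// ltW.
nra.
Qed.

End RealForm.

(** * Completeness with respect to the quadratic form *)

Section Completeness.
Context {R : realType}.
Local Notation mu := (@lebesgue_measure R).
Variable W : R -> R.
Hypothesis hW : hardy_potential W.
Implicit Types (a b : R -> R).

Lemma sq_norm_le_quad a : finite_energy a ->
  \int[mu]_x (a x ^+ 2) <= pi * real_quad W a.
Proof.
move=> fa; have h1 := sq_norm_le_energy fa; have h2 := energy_le_quad hW a.
rewrite -(ler_pM2l (x := 4))//; apply: le_trans h1 _; apply: le_trans h2 _.
by rewrite mulrA.
Qed.

(** Young's inequality |t| <= s t^2 + 1 / (2 s), integrated over an interval of length 2. Taking s =
    2^n turns mean-square increments of order 4^-n into mean increments of order 2^-n. *)
Lemma Rint_norm_le a (s : R) : 0 < s -> sq_integrable a ->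
  \int[mu]_x `|a x| <= s * \int[mu]_x (a x ^+ 2) + s^-1.
Proof.
move=> s0 sa; have [ma ja2 supp] := sa; have ja := sq_integrable_intg sa.
have jc := @intg_chi R.
have Ic : \int[mu]_x chi x = 2 :> R by rewrite /Rintegral integral_chi.
have -> : s * \int[mu]_x (a x ^+ 2) + s^-1 =
   \int[mu]_x (s * a x ^+ 2 + s^-1 / 2 * chi x).
  by rewrite RintD ?intgZ// !RintZ// Ic divfK.
apply: ler_Rint; [exact: intg_norm|by apply: intgD; apply: intgZ|move=> x].
have [xI|xI] := pselect (`[-1, 1]%classic x); last first.
  by rewrite supp// normr0 expr0n mulr0 add0r chi_out// mulr0.
rewrite chi_in// mulr1 -[a x ^+ 2]real_normK ?num_real//.
have t0 := normr_ge0 (a x); move: `|a x| t0 => t t0.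
rewrite -(ler_pM2l s0) mulrDr !mulrA mulfV ?gt_eqF// mul1r.
by have := sqr_ge0 (s * t - 2^-1); nra.
Qed.

(** The Riesz-Fischer argument: the sum of the absolute increments has a finite integral, hence is
    finite almost everywhere; where it is finite the sequence converges, and the sum plus |a_0|
    dominates it. *)
Lemma l1_convergence (a_ : nat -> R -> R) (C : R) :
  (forall n, sq_integrable (a_ n)) ->
  (forall n, \int[mu]_x `|a_ n.+1 x + -1 * a_ n x| <= C * 2^-1 ^+ n) ->
  exists a h, [/\ measurable_fun setT a, supported a, intg mu h,
    {ae mu, forall x, a_ n x @[n --> \oo] --> a x} &
    {ae mu, forall x, forall n, `|a_ n x| <= h x}].
Proof.
move=> sa hd.
pose d n x : R := `|a_ n.+1 x + -1 * a_ n x|.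
have ja n : intg mu (a_ n) by exact: sq_integrable_intg.
have jd n : intg mu (d n) by apply: intg_norm; apply: intgD => //; exact: intgZ.
have md n : measurable_fun setT (d n) := intg_measurable (jd n).
have mdE n : measurable_fun setT (EFin \o d n) by apply/measurable_EFinP; exact: md.
pose g x := (\sum_(n <oo) (d n x)%:E)%E.
have C0 : 0 <= C.
  by have := hd 0%N; rewrite expr0 mulr1; apply: le_trans; exact: Rintegral_ge0.
have d0 n x : setT x -> (0 <= (EFin \o d n) x)%E by move=> _ /=; rewrite lee_fin /d normr_ge0.
have gint : (\int[mu]_x g x <= (2 * C)%:E)%E.
  rewrite (integral_nneseries mu measurableT mdE d0).
  (* The bound C / 2^n is written as 2 C / 2^(n+1), a geometric series with sum 2 C. *)
  apply: (@le_trans _ _ (\sum_(n <oo) ((2 * C) / (2 ^ n.+1)%:R)%:E)%E); last first.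
    by apply: epsilon_trick0; rewrite mulr_ge0.
  apply: lee_nneseries => [n _ _|n _].
    by apply: integral_ge0 => x _; rewrite lee_fin /d normr_ge0.
  rewrite intg_EFin// lee_fin; apply: le_trans (hd n) _.
  rewrite natrX exprS invfM [2 * C]mulrC -mulrA mulVKf// exprVn//.
have g0 x : (0 <= g x)%E by apply: nneseries_ge0 => n _ _; rewrite lee_fin /d normr_ge0.
have mg : measurable_fun setT g.
  by apply: ge0_emeasurable_sum => [n x _ _|n _]; [rewrite lee_fin /d normr_ge0|exact: mdE].
have jg : mu.-integrable setT g.
  apply/integrableP; split => //; under eq_integral do rewrite gee0_abs//.
  exact: le_lt_trans gint (ltry _).
have aeg : {ae mu, forall x, (g x < +oo)%E}.
  apply: ae_mono (integrable_ae measurableT jg) => x /(_ I).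
  by rewrite ge0_fin_numE.
pose A := [set x | (g x < +oo)%E].
have mA : measurable A.
  by rewrite -[A]setTI; apply: measurable_lte => //; exact: measurable_cst.
have part x n : A x -> \sum_(0 <= i < n) d i x <= fine (g x).
  move=> gx; have gE : g x = (fine (g x))%:E by rewrite fineK// ge0_fin_numE.
  rewrite -lee_fin -gE -sumEFin; apply: nneseries_lim_ge => i _ _.
  by rewrite lee_fin /d normr_ge0.
have cvgA x : A x -> cvgn (fun n => a_ n x).
  move=> gx.
  have s1 : cvgn [normed series (fun n => a_ n.+1 x - a_ n x)].
    apply: nondecreasing_is_cvgn.
      by apply: nondecreasing_series => n _ _; exact: normr_ge0.
    exists (fine (g x)) => _ [n _ <-] /=; apply: le_trans (part x n gx).
    by rewrite /series /= le_eqVlt; apply/orP; left; apply/eqP; apply: eq_bigr => i _; rewrite /d mulN1r.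
  have := @normed_cvg R R _ s1.
  rewrite -/(telescope (fun n => a_ n x)) telescopeK => /cvg_ex[l cl].
  apply/cvg_ex; exists (a_ 0%N x + l).
  rewrite (_ : (fun n => a_ n x) = (fun n => a_ 0%N x + (a_ n x - a_ 0%N x))).
    by apply: cvgD; [exact: cvg_cst|exact: cl].
  by apply/funext => n; rewrite addrC subrK.
have bound x n : A x -> `|a_ n x| <= `|a_ 0%N x| + fine (g x).
  move=> gx; apply: le_trans (lerD (lexx _) (part x n gx)).
  elim: n => [|n IH]; first by rewrite big_nil addr0.
  rewrite big_nat_recr//= addrA; apply: le_trans (lerD IH (lexx _)).
  have -> : a_ n.+1 x = a_ n x + (a_ n.+1 x + -1 * a_ n x) by ring.
  exact: ler_normD.
(* Cutting off to [A] makes the sequence converge at every point, so that its limit is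
   measurable. *)
pose b n x := a_ n x * \1_A x.
pose a x : R := limn (fun n => b n x).
have cb x : b n x @[n --> \oo] --> a x.
  have [xA|xA] := pselect (A x).
    rewrite /a /b indicE mem_set//=; under eq_fun do rewrite mulr1.
    exact: cvgA.
  rewrite /a /b indicE memNset//=; under eq_fun do rewrite mulr0.
  by rewrite (_ : (fun n : nat => 0) = cst 0)// lim_cst//; exact: cvg_cst.
exists a, (fun x => `|a_ 0%N x| + fine (g x)); split.
- apply: (@measurable_fun_cvg _ _ _ setT b) => // n.
  by apply: measurable_funM; [have [] := sa n|exact: measurable_indic].
- move=> x xI; rewrite /a (_ : (fun n => b n x) = cst 0) ?lim_cst//.
  by apply/funext => n; rewrite /b; have [_ _ ->] := sa n; rewrite ?mul0r.
- apply: intgD; first exact: intg_norm.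
  apply: intg_lty; first exact: measurableT_comp.
    by move=> x; rewrite fine_ge0.
  apply: le_lt_trans (le_lt_trans gint (ltry _)); apply: ge0_le_integral => //.
  - by move=> x _; rewrite lee_fin fine_ge0.
  - by apply/measurable_EFinP; exact: measurableT_comp.
  - by move=> x _; move: (g0 x); case: (g x) => //= *; rewrite leey.
- apply: ae_mono aeg => x gx; have := cb x; rewrite /b indicE mem_set//=.
  by under eq_fun do rewrite mulr1.
- by apply: ae_mono aeg => x gx n; exact: bound.
Qed.

Lemma cvg_cos_transform (a_ : nat -> R -> R) a h z :
  (forall n, measurable_fun setT (a_ n)) -> measurable_fun setT a -> intg mu h ->
  {ae mu, forall x, a_ n x @[n --> \oo] --> a x} ->
  {ae mu, forall x, forall n, `|a_ n x| <= h x} ->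
  cos_transform (a_ n) z @[n --> \oo] --> cos_transform a z /\
  sin_transform (a_ n) z @[n --> \oo] --> sin_transform a z.
Proof.
move=> ma_ ma jh ca ha.
have mc : measurable_fun setT (fun x : R => cos (x * z)).
  exact: (measurable_fun_pair1 _ measurable_cos_kernel).
have ms : measurable_fun setT (fun x : R => sin (x * z)).
  exact: (measurable_fun_pair1 _ measurable_sin_kernel).
have H (k : R -> R) : measurable_fun setT k -> (forall x, `|k x| <= 1) ->
    \int[mu]_x (a_ n x * k x) @[n --> \oo] --> \int[mu]_x (a x * k x).
  move=> mk k1; have [] // := @dominated_Rint _ _ _ mu (fun n x => a_ n x * k x)
    (fun x => a x * k x) h.
  - by move=> n; exact: measurable_funM (ma_ n) mk.
  - exact: measurable_funM.
  - by apply: ae_mono ca => x cx; apply: cvgMr_tmp.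
  - apply: ae_mono ha => x hx n; apply: le_trans (hx n).
    by rewrite normrM ler_piMr.
split; first by apply: (H (fun x => cos (x * z))) => // x; exact: cos_max.
by apply: (H (fun x => sin (x * z))) => // x; exact: sin_max.
Qed.

(** The limit is an almost everywhere one, under a common integrable bound, so the cosine and sine
    transforms converge at each frequency. Fatou's lemma then bounds the mean square, the potential
    term and the energy of [a - a_ n] separately; the last two account for the factor 2. *)
Lemma real_complete (a_ : nat -> R -> R) : (forall n, finite_energy (a_ n)) ->
  (forall n m, (n <= m)%N -> real_quad W (fun x => a_ m x + -1 * a_ n x) <= 4^-1 ^+ n) ->
  exists2 a, finite_energy a &
    forall n, real_quad W (fun x => a x + -1 * a_ n x) <= 2 * 4^-1 ^+ n.
Proof.
move=> fa hq; have pi0 : 0 < pi :> R by exact: pi_gt0.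
have fd n m : finite_energy (fun x => a_ m x + -1 * a_ n x) by exact: finite_energyD.
have [|n|a [h [ma supp jh ca ha]]] := @l1_convergence a_ (pi + 1).
- by move=> n; have [] := fa n.
- have p2 : 0 < 2 ^+ n :> R by rewrite exprn_gt0.
  apply: le_trans (Rint_norm_le p2 (fd n n.+1).1) _.
  have h1 := sq_norm_le_quad (fd n n.+1).
  have h2 : \int[mu]_x ((a_ n.+1 x + -1 * a_ n x) ^+ 2) <= pi * 4^-1 ^+ n.
    by apply: le_trans h1 _; rewrite ler_wpM2l ?(ltW pi0)// hq.
  apply: le_trans (lerD (ler_wpM2l (ltW p2) h2) (lexx _)) _.
  have -> : 2 ^+ n * (pi * 4^-1 ^+ n) = pi * 2^-1 ^+ n :> R.
    by rewrite mulrCA -exprMn; congr (_ * _ ^+ n); field.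
  by rewrite [leRHS]mulrDl mul1r -exprVn.
have ma_ n : measurable_fun setT (a_ n) by have [[]] := fa n.
have CT z := cvg_cos_transform z ma_ ma jh ca ha.
have cshift (u : nat -> R) (l : R) n : u k @[k --> \oo] --> l -> u (k + n)%N @[k --> \oo] --> l.
  by move=> cu; exact: (cvg_comp _ u (cvg_addnr n) cu).
have ja : intg mu a.
  have [] // := @dominated_Rint _ _ _ mu a_ a h.
have key n : [/\ sq_integrable (fun x => a x + -1 * a_ n x),
   finite_energy (fun x => a x + -1 * a_ n x) &
   real_quad W (fun x => a x + -1 * a_ n x) <= 2 * 4^-1 ^+ n].
  have mk : measurable_fun setT (fun x => a x + -1 * a_ n x).
    by apply: measurable_funD => //; apply: measurable_funM.
  have cd : {ae mu, forall x, (a_ (k + n)%N x + -1 * a_ n x) @[k --> \oo] --> a x + -1 * a_ n x}.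
    by apply: ae_mono ca => x cx; apply: cvgD; [exact: (cshift (fun k => a_ k x))|exact: cvg_cst].
  have hb k : real_quad W (fun x => a_ (k + n)%N x + -1 * a_ n x) <= 4^-1 ^+ n.
    by apply: hq; rewrite leq_addl.
  have [j2 _] : intg mu (fun x => (a x + -1 * a_ n x) ^+ 2) /\
     \int[mu]_x ((a x + -1 * a_ n x) ^+ 2) <= pi * 4^-1 ^+ n.
    apply: (@fatou_Rint _ _ _ mu (fun k x => (a_ (k + n)%N x + -1 * a_ n x) ^+ 2) _
      (fun=> pi * 4^-1 ^+ n)).
    - by move=> k; have [[]] := fd n (k + n)%N.
    - by move=> k x; exact: sqr_ge0.
    - exact: measurable_funX.
    - by move=> x; exact: sqr_ge0.
    - by apply: ae_mono cd => x cx; exact: cvg_comp cx (@exprn_continuous R 2 _).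
    - move=> k; apply: le_trans (sq_norm_le_quad (fd _ _)) _.
      by rewrite ler_wpM2l ?(ltW pi0).
    - exact: cvg_cst.
  have sk : sq_integrable (fun x => a x + -1 * a_ n x).
    split => // x xI; rewrite supp//; have [[_ _ ->//] _] := fa n.
    by rewrite mulr0 addr0.
  have mW : measurable_fun setT W by case: hW => K [].
  have W0 x : 0 <= W x by case: hW => K [].
  have [_ hW'] : intg mu (fun x => W x * (a x + -1 * a_ n x) ^+ 2) /\
     \int[mu]_x (W x * (a x + -1 * a_ n x) ^+ 2) <= 4^-1 ^+ n.
    apply: (@fatou_Rint _ _ _ mu (fun k x => W x * (a_ (k + n)%N x + -1 * a_ n x) ^+ 2) _
      (fun=> 4^-1 ^+ n)).
    - by move=> k; exact: intg_potential_sqr (fd _ _).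
    - by move=> k x; rewrite mulr_ge0 ?sqr_ge0.
    - by apply: measurable_funM => //; exact: measurable_funX.
    - by move=> x; rewrite mulr_ge0 ?sqr_ge0.
    - apply: ae_mono cd => x cx; apply: cvgMl_tmp.
      exact: cvg_comp cx (@exprn_continuous R 2 _).
    - move=> k; apply: le_trans (hb k); rewrite real_quadE lerDl.
      by rewrite mulr_ge0 ?energy_ge0// invr_ge0 mulr_ge0// ltW.
    - exact: cvg_cst.
  have [jE hE] : intg mu (fun z => `|z| * spectral_density (fun x => a x + -1 * a_ n x) z) /\
     energy (fun x => a x + -1 * a_ n x) <= 4 * pi * 4^-1 ^+ n.
    apply: (@fatou_Rint _ _ _ mu (fun k z => `|z| *
      spectral_density (fun x => a_ (k + n)%N x + -1 * a_ n x) z) _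
      (fun=> 4 * pi * 4^-1 ^+ n)).
    - by move=> k; have [] := fd n (k + n)%N.
    - by move=> k x; rewrite mulr_ge0 ?spectral_density_ge0.
    - apply: measurable_funM; first exact: measurable_absR.
      by apply: measurable_spectral_density; exact: sq_integrable_intg.
    - by move=> x; rewrite mulr_ge0 ?spectral_density_ge0.
    - apply: aeW => z; apply: cvgMl_tmp.
      have jn k : intg mu (a_ k) by have [/sq_integrable_intg] := fa k.
      have [C S] := CT z.
      rewrite /spectral_density cos_transformD// sin_transformD//.
      under eq_fun do rewrite cos_transformD// sin_transformD//.
      have sq (u : nat -> R) (l : R) : u k @[k --> \oo] --> l -> u k ^+ 2 @[k --> \oo] --> l ^+ 2.
        by move=> cu; exact: cvg_comp cu (@exprn_continuous R 2 _).
      apply: cvgD; apply: sq; apply: cvgD; try exact: cvg_cst.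
        exact: (cshift (fun k => cos_transform (a_ k) z)).
      exact: (cshift (fun k => sin_transform (a_ k) z)).
    - move=> k; apply: le_trans (energy_le_quad hW _) _.
      by rewrite ler_wpM2l// mulr_ge0// ltW.
    - exact: cvg_cst.
  split => //; rewrite real_quadE [leRHS]mulr_natl [leRHS]mulr2n lerD//.
  by rewrite ler_pdivrMl// mulr_gt0.
exists a; last by move=> n; have [] := key n.
(* Only differences have been estimated so far; [a] itself is recovered as (a - a_0) + a_0. *)
have [_ f0 _] := key 0%N; have := finite_energyD 1 f0 (fa 0%N).
by congr finite_energy; apply/funext => x; ring.
Qed.

End Completeness.

(** * Riesz representation *)

Section Riesz.
(** Here [comb u c v] stands for u + c v. The form is only semidefinite, so that functions need not
    be identified when almost everywhere equal. Completeness is phrased with a rate; the factor 4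
    leaves room for a real and an imaginary part, each with its factor 2. *)
Variables (R : realType) (T : Type) (X : set T) (comb : T -> R -> T -> T).
Variables (B : T -> T -> R) (l : T -> R).
Hypotheses (X_nonempty : X !=set0)
  (X_comb : forall u c v, X u -> X v -> X (comb u c v))
  (B_comb : forall u c v w, X u -> X v -> X w -> B (comb u c v) w = B u w + c * B v w)
  (B_sym : forall u v, X u -> X v -> B u v = B v u)
  (B_ge0 : forall u, X u -> 0 <= B u u)
  (l_comb : forall u c v, X u -> X v -> l (comb u c v) = l u + c * l v)
  (l_bounded : exists C, forall u, X u -> l u ^+ 2 <= C * B u u)
  (comb_sub : forall u v, comb u 1 (comb v (-1) u) = v)
  (X_complete : forall u_ : nat -> T, (forall n, X (u_ n)) ->
     (forall n m, (n <= m)%N ->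
        B (comb (u_ m) (-1) (u_ n)) (comb (u_ m) (-1) (u_ n)) <= 4^-1 ^+ n) ->
     exists2 u, X u & forall n,
        B (comb u (-1) (u_ n)) (comb u (-1) (u_ n)) <= 4 * 4^-1 ^+ n).

Let quad_comb u c v : X u -> X v ->
  B (comb u c v) (comb u c v) = B u u + 2 * c * B u v + c ^+ 2 * B v v.
Proof.
move=> Xu Xv; have Xw := X_comb c Xu Xv.
rewrite B_comb// (B_sym Xu Xw) (B_sym Xv Xw) !B_comb// (B_sym Xv Xu); ring.
Qed.

(** Dirichlet's principle: the representative of [l] is sought by minimizing this functional. *)
Let J u := B u u - 2 * l u.

Let J_comb u c v : X u -> X v ->
  J (comb u c v) = J u + 2 * c * (B u v - l v) + c ^+ 2 * B v v.
Proof. by move=> Xu Xv; rewrite /J quad_comb// l_comb//; ring. Qed.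

(** A Cauchy-Schwarz inequality with an error term, read off at c = d and c = - d. A discriminant is
    avoided, so [q] may vanish. *)
Let cauchy_schwarz_gap (a b q d : R) : 0 < d ->
  (forall c, 0 <= d ^+ 2 * a + 2 * c * b + c ^+ 2 * q) -> `|b| <= d * (a + q).
Proof.
move=> d0 H; rewrite ler_norml; apply/andP; split.
  have := H d; rewrite (_ : _ + _ + _ = d * (d * (a + q) + 2 * b)); last by ring.
  rewrite pmulr_rge0// => h.
  have : 0 <= d * (a + q).
    have := H (- d); rewrite (_ : _ + _ + _ = d * (d * (a + q) - 2 * b)); last by ring.
    by rewrite pmulr_rge0//; lra.
  lra.
have := H (- d); rewrite (_ : _ + _ + _ = d * (d * (a + q) - 2 * b)); last by ring.
rewrite pmulr_rge0// => h.
have : 0 <= d * (a + q).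
  have := H d; rewrite (_ : _ + _ + _ = d * (d * (a + q) + 2 * b)); last by ring.
  by rewrite pmulr_rge0//; lra.
lra.
Qed.

Lemma riesz_representation : exists2 u, X u & forall v, X v -> B u v = l v.
Proof.
have [C lC] := l_bounded.
have Jlb u : X u -> - `|C| <= J u.
  move=> Xu; have q0 := B_ge0 Xu; have c0 := normr_ge0 C.
  have : l u ^+ 2 <= `|C| * B u u.
    by apply: le_trans (lC u Xu) _; rewrite ler_wpM2r// ler_norm.
  rewrite /J; move: (B u u) (l u) `|C| q0 c0 => q t c q0 c0 h.
  rewrite lerBrDr addrC -lerBrDr opprK leNgt; apply/negP => h'.
  (* If 2 t > q + c, then 4 t^2 > (q + c)^2 >= 4 c q, against the bound on t^2. *)
  have := sqr_ge0 (q - c); nra.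
have iS : has_inf [set J u | u in X].
  split; first by have [u Xu] := X_nonempty; exists (J u), u.
  by exists (- `|C|) => _ [u Xu <-]; exact: Jlb.
set j := inf [set J u | u in X].
have jle u : X u -> j <= J u by move=> Xu; apply: ge_inf; [exact: iS.2|exists u].
(* The division by 4 is calibrated so that comparison with the midpoint of [u_ m] and [u_ n] gives
   exactly the rate 4^-n of [X_complete]. *)
have e0 n : 0 < (4^-1 ^+ n / 4 : R) by rewrite divr_gt0// exprn_gt0// invr_gt0.
(* A minimizing sequence of [J]; by the parallelogram identity it is Cauchy. *)
have exu n : exists u, X u /\ J u < j + 4^-1 ^+ n / 4.
  by have [_ [u Xu <-] h] := inf_adherent (e0 n) iS; exists u.
have [u_ /all_and2[Xu_ Ju_]] := choice exu.
have [|u Xu Hu] := X_complete Xu_.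
  move=> n m nm; have Xw := X_comb (-1) (Xu_ m) (Xu_ n).
  have E1 := J_comb 1 (Xu_ n) Xw; have E2 := J_comb 2^-1 (Xu_ n) Xw.
  have h := jle _ (X_comb 2^-1 (Xu_ n) Xw).
  rewrite comb_sub in E1; rewrite E2 in h.
  have := Ju_ n; have := Ju_ m.
  have : 4^-1 ^+ m <= 4^-1 ^+ n :> R by apply: ler_wiXn2l => //; lra.
  move: E1 h; move: (comb (u_ m) (-1) (u_ n)) => w.
  move: (B (u_ n) w - l w) (B w w) (J (u_ m)) (J (u_ n)) (4^-1 ^+ m) (4^-1 ^+ n).
  by move=> ? ? ? ? ? ?; lra.
exists u => // v Xv; have q0 := B_ge0 Xv.
(* Minimality is not transferred to the limit; the Euler equation is. It holds for [u_ n] up to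
   order 2^-n by near-minimality, and replacing [u_ n] by [u] costs the same order. *)
have H n : `|B u v - l v| <= 2^-1 ^+ n * (5 + 2 * B v v).
  have d0 : 0 < 2^-1 ^+ n :> R by rewrite exprn_gt0.
  have d2 : (2^-1 ^+ n) ^+ 2 = 4^-1 ^+ n :> R.
    by rewrite exprAC; congr (_ ^+ n); field.
  have Xw := X_comb (-1) Xu (Xu_ n).
  have h1 : `|B (u_ n) v - l v| <= 2^-1 ^+ n * (1 + B v v).
    apply: cauchy_schwarz_gap => // c; rewrite d2.
    have := jle _ (X_comb c (Xu_ n) Xv); rewrite J_comb//.
    by have := Ju_ n; have := e0 n; lra.
  have h2 : `|B (comb u (-1) (u_ n)) v| <= 2^-1 ^+ n * (4 + B v v).
    apply: cauchy_schwarz_gap => // c; rewrite d2.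
    have := B_ge0 (X_comb c Xw Xv); rewrite quad_comb//.
    by have := Hu n; lra.
  have -> : B u v - l v = (B (u_ n) v - l v) + B (comb u (-1) (u_ n)) v.
    by rewrite B_comb//; ring.
  apply: le_trans (ler_normD _ _) _; apply: le_trans (lerD h1 h2) _.
  by rewrite -mulrDr ler_wpM2l ?(ltW d0)//; lra.
apply/eqP; rewrite -subr_eq0 -normr_le0.
have c : 2^-1 ^+ n * (5 + 2 * B v v) @[n --> \oo] --> (0 : R).
  rewrite -[X in _ --> X](mul0r (5 + 2 * B v v)); apply: cvgMr_tmp.
  by apply: cvg_expr; rewrite ger0_norm; lra.
by apply: (cvgr_to_ge c); exact: nearW.
Qed.

End Riesz.

(** * Complex-valued functions *)

Section Reflection.
Context {R : realType}.
Local Notation mu := (@lebesgue_measure R).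
Implicit Types (f a b w : R -> R) (z : R).

Lemma measurable_oppR : measurable_fun setT (fun z : R => - z).
Proof. by apply: continuous_measurable_fun; exact: opp_continuous. Qed.

Lemma ge0_integral_opp (f : R -> \bar R) : measurable_fun setT f ->
  (forall z, (0 <= f z)%E) -> (\int[mu]_z f (- z)%R = \int[mu]_z f z)%E.
Proof.
move=> mf f0.
have := @ge0_integral_pushforward _ _ (measurableTypeR R) (measurableTypeR R) R
   (fun z => - z) measurable_oppR mu setT f measurableT mf (fun z _ => f0 z).
rewrite preimage_setT => <-.
apply: eq_measure_integral => [|mN A mA _]; first exact: measurable_oppR.
exact: lebesgue_measureN.
Qed.

Lemma intg_opp f : intg mu f -> intg mu (fun z => f (- z)).
Proof.
move=> jf; have mf := intg_measurable jf; have /integrableP[_ fi] := jf.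
apply/integrableP; split.
  by apply/measurable_EFinP; exact: (measurableT_comp mf measurable_oppR).
rewrite (ge0_integral_opp (f := fun z => `|(EFin \o f) z|%E)) //.
by apply: measurableT_comp => //; exact/measurable_EFinP.
Qed.

(** Reduced to the nonnegative case, as [f] is the difference of |f| + f and |f|. *)
Lemma Rint_opp f : intg mu f -> \int[mu]_z f (- z) = \int[mu]_z f z.
Proof.
move=> jf; have mf := intg_measurable jf.
have jn := intg_norm jf.
have jp : intg mu (fun z => `|f z| + f z) by exact: intgD.
have p0 z : 0 <= `|f z| + f z by rewrite -lerBlDr sub0r -normrN ler_norm.
have E (g : R -> R) : intg mu g -> (forall z, 0 <= g z) ->
    \int[mu]_z g (- z) = \int[mu]_z g z.
  move=> jg g0.
  have mg : measurable_fun setT (EFin \o g).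
    by apply/measurable_EFinP; exact: intg_measurable jg.
  by rewrite /Rintegral -(ge0_integral_opp mg)// => z; rewrite lee_fin.
have := E _ jp p0; rewrite (RintD jn jf) (RintD (intg_opp jn) (intg_opp jf)).
by rewrite (E _ jn (fun z => normr_ge0 _)) => /addrI.
Qed.

Lemma Rint_odd f : intg mu f -> (forall z, f (- z) = - f z) -> \int[mu]_z f z = 0.
Proof.
move=> jf odd; have := Rint_opp jf.
under eq_Rintegral do rewrite odd -mulN1r.
by rewrite RintZ// => h; lra.
Qed.

Lemma cos_transformN a z : cos_transform a (- z) = cos_transform a z.
Proof. by apply: eq_Rintegral => x _; rewrite mulrN cosN. Qed.

Lemma sin_transformN a z : intg mu a -> sin_transform a (- z) = - sin_transform a z.
Proof.
move=> ja; rewrite -[RHS]mulN1r /sin_transform -RintZ; last exact: intg_mul_sin.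
by apply: eq_Rintegral => x _; rewrite mulrN sinN; ring.
Qed.

Lemma spectral_densityN a z : intg mu a -> spectral_density a (- z) = spectral_density a z.
Proof. by move=> ja; rewrite /spectral_density cos_transformN sin_transformN// sqrrN. Qed.

(** The imaginary part of [fourier a z * conjc (fourier b z)] for real-valued [a] and [b]; it
    carries all mixing of real and imaginary parts. *)
Definition cross_density a b z : R :=
  sin_transform a z * cos_transform b z - cos_transform a z * sin_transform b z.

Lemma cross_densityN a b z : intg mu a -> intg mu b ->
  cross_density a b (- z) = - cross_density a b z.
Proof.
move=> ja jb; rewrite /cross_density !cos_transformN !sin_transformN//.
by rewrite mulNr mulrN opprB opprK addrC.
Qed.

Lemma cross_density_le a b z :
  `|cross_density a b z| <= spectral_density a z + spectral_density b z.
Proof.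
rewrite /cross_density /spectral_density.
move: (cos_transform a z) (cos_transform b z) (sin_transform a z) (sin_transform b z) => p q r s.
have := sqr_ge0 (r + q); have := sqr_ge0 (r - q); have := sqr_ge0 (p + s); have := sqr_ge0 (p - s).
have := sqr_ge0 p; have := sqr_ge0 q; have := sqr_ge0 r; have := sqr_ge0 s.
by rewrite ler_norml => ????????; apply/andP; split; nra.
Qed.

Lemma intg_cross_density w a b : measurable_fun setT w -> (forall z, 0 <= w z) ->
  (forall z, w (- z) = w z) -> intg mu a -> intg mu b ->
  intg mu (fun z => w z * spectral_density a z) ->
  intg mu (fun z => w z * spectral_density b z) ->
  intg mu (fun z => w z * cross_density a b z) /\
  \int[mu]_z (w z * cross_density a b z) = 0.
Proof.
move=> mw w0 wN ja jb Ja Jb.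
have j : intg mu (fun z => w z * cross_density a b z).
  apply: (@intg_le _ _ _ mu _ (fun z => w z * spectral_density a z + w z * spectral_density b z)).
  - apply: measurable_funM => //; exact: (measurable_funB
      (measurable_funM (measurable_sin_transform ja) (measurable_cos_transform jb))
      (measurable_funM (measurable_cos_transform ja) (measurable_sin_transform jb))).
  - by move=> z; rewrite normrM (ger0_norm (w0 z)) -mulrDr ler_wpM2l// cross_density_le.
  - exact: intgD.
by split => //; apply: Rint_odd => // z; rewrite wN cross_densityN// mulrN.
Qed.

End Reflection.

(** * Reduction of H00 and its norm to real and imaginary parts *)

Section ComplexReduction.
Context {R : realType}.
Local Notation mu := (@lebesgue_measure R).
Local Notation Re := complex.Re.
Local Notation Im := complex.Im.
Local Notation modulus := ComplexField.Normc.normc.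
Local Open Scope complex_scope.
Implicit Types (u v g : R -> R[i]) (z x : R).

Lemma cReM (p q : R[i]) : Re (p * q) = Re p * Re q - Im p * Im q.
Proof. by case: p => a b; case: q. Qed.

Lemma cImM (p q : R[i]) : Im (p * q) = Re p * Im q + Im p * Re q.
Proof. by case: p => a b; case: q. Qed.

Lemma cReD (p q : R[i]) : Re (p + q) = Re p + Re q.
Proof. by case: p => a b; case: q. Qed.

Lemma cImD (p q : R[i]) : Im (p + q) = Im p + Im q.
Proof. by case: p => a b; case: q. Qed.

Lemma cReJ (p : R[i]) : Re (conjc p) = Re p. Proof. by case: p. Qed.
Lemma cImJ (p : R[i]) : Im (conjc p) = - Im p. Proof. by case: p. Qed.

Lemma complex_ext (p q : R[i]) : Re p = Re q -> Im p = Im q -> p = q.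
Proof. by case: p => a b; case: q => c d /= -> ->. Qed.

Lemma sqr_modulus (p : R[i]) : modulus p ^+ 2 = Re p ^+ 2 + Im p ^+ 2.
Proof. by case: p => a b /=; rewrite sqr_sqrtr// addr_ge0 ?sqr_ge0. Qed.

Lemma modulus_ge0 (p : R[i]) : 0 <= modulus p.
Proof. by case: p => a b /=; exact: sqrtr_ge0. Qed.

Lemma Re_le_modulus (p : R[i]) : `|Re p| <= modulus p.
Proof.
rewrite -(ger0_norm (modulus_ge0 p)) -ler_sqr ?nnegrE// !real_normK ?num_real//.
by rewrite sqr_modulus lerDl sqr_ge0.
Qed.

(** The cut-off turns the almost everywhere vanishing outside [-1, 1] into the pointwise vanishing
    that [supported] asks for. *)
Definition re_part u x : R := Re (u x) * chi x.
Definition im_part u x : R := Im (u x) * chi x.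

Definition vanishing u := {ae mu, forall x, ~ `[-1, 1]%classic x -> u x = 0}.

Lemma ae_re_part u : vanishing u -> {ae mu, forall x, Re (u x) = re_part u x}.
Proof.
apply: ae_mono => x ux; rewrite /re_part.
have [xI|xI] := pselect (`[-1, 1]%classic x); first by rewrite chi_in// mulr1.
by rewrite ux// mul0r.
Qed.

Lemma ae_im_part u : vanishing u -> {ae mu, forall x, Im (u x) = im_part u x}.
Proof.
apply: ae_mono => x ux; rewrite /im_part.
have [xI|xI] := pselect (`[-1, 1]%classic x); first by rewrite chi_in// mulr1.
by rewrite ux// mul0r.
Qed.

Lemma supported_re_part u : supported (re_part u).
Proof. by move=> x xI; rewrite /re_part chi_out// mulr0. Qed.

Lemma supported_im_part u : supported (im_part u).
Proof. by move=> x xI; rewrite /im_part chi_out// mulr0. Qed.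

Lemma measurable_re_part u : cmeasurable u -> measurable_fun setT (re_part u).
Proof. by move=> [m _]; apply: measurable_funM => //; exact: measurable_chi. Qed.

Lemma measurable_im_part u : cmeasurable u -> measurable_fun setT (im_part u).
Proof. by move=> [_ m]; apply: measurable_funM => //; exact: measurable_chi. Qed.

Lemma fourierE u z : cmeasurable u -> vanishing u ->
  intg mu (re_part u) -> intg mu (im_part u) ->
  fourier u z =
  (cos_transform (re_part u) z - sin_transform (im_part u) z) +i*
  (sin_transform (re_part u) z + cos_transform (im_part u) z).
Proof.
move=> mu_ vu ja jb; have [mre mim] := mu_.
have mc : measurable_fun setT (fun x : R => cos (x * z)).
  exact: (measurable_fun_pair1 _ measurable_cos_kernel).
have ms : measurable_fun setT (fun x : R => sin (x * z)).
  exact: (measurable_fun_pair1 _ measurable_sin_kernel).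
have aeab := ae_and (ae_re_part vu) (ae_im_part vu).
have jac := intg_mul_cos z ja; have jas := intg_mul_sin z ja.
have jbc := intg_mul_cos z jb; have jbs := intg_mul_sin z jb.
rewrite /fourier /cintegral; congr (_ +i* _).
- rewrite /cos_transform /sin_transform -RintB//.
  apply: ae_Rint.
  + rewrite (_ : (fun x => _) = (fun x => Re (u x) * cos (x * z) - Im (u x) * sin (x * z))).
      exact: measurable_funB (measurable_funM mre mc) (measurable_funM mim ms).
    by apply/funext => x; rewrite cReM.
  + by apply: intg_measurable (intgB jac jbs).
  + by apply: ae_mono aeab => x [h1 h2]; rewrite cReM /= h1 h2.
- rewrite /cos_transform /sin_transform -RintD//.
  apply: ae_Rint.
  + rewrite (_ : (fun x => _) = (fun x => Re (u x) * sin (x * z) + Im (u x) * cos (x * z))).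
      exact: measurable_funD (measurable_funM mre ms) (measurable_funM mim mc).
    by apply/funext => x; rewrite cImM.
  + by apply: intg_measurable (intgD jas jbc).
  + by apply: ae_mono aeab => x [h1 h2]; rewrite cImM /= h1 h2.
Qed.

Lemma sq_integrable_parts u : cmeasurable u -> vanishing u ->
  (\int[mu]_x (modulus (u x) ^+ 2)%:E < +oo)%E <->
  sq_integrable (re_part u) /\ sq_integrable (im_part u).
Proof.
move=> mu_ vu; have [mre mim] := mu_.
have ma := measurable_re_part mu_; have mb := measurable_im_part mu_.
have mm : measurable_fun setT (fun x => modulus (u x) ^+ 2).
  rewrite (_ : (fun x => _) = (fun x => Re (u x) ^+ 2 + Im (u x) ^+ 2)).
    by apply: measurable_funD; exact: measurable_funX.
  by apply/funext => x; rewrite sqr_modulus.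
have mab : measurable_fun setT (fun x => re_part u x ^+ 2 + im_part u x ^+ 2).
  by apply: measurable_funD; exact: measurable_funX.
have aeab : {ae mu, forall x, modulus (u x) ^+ 2 = re_part u x ^+ 2 + im_part u x ^+ 2}.
  apply: ae_mono (ae_and (ae_re_part vu) (ae_im_part vu)) => x [h1 h2].
  by rewrite sqr_modulus h1 h2.
split=> [fin|[[_ ja _] [_ jb _]]].
  have jm : intg mu (fun x => modulus (u x) ^+ 2).
    by apply: intg_lty => // x; exact: sqr_ge0.
  have jab := @ae_intg _ _ _ mu (fun x => modulus (u x) ^+ 2) _ mab aeab jm.
  split; split.
  - exact: ma.
  - apply: (@intg_le _ _ _ mu _ _ _ _ jab); first exact: measurable_funX.
    by move=> x; rewrite ger0_norm ?sqr_ge0// lerDl sqr_ge0.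
  - exact: supported_re_part.
  - exact: mb.
  - apply: (@intg_le _ _ _ mu _ _ _ _ jab); first exact: measurable_funX.
    by move=> x; rewrite ger0_norm ?sqr_ge0// lerDr sqr_ge0.
  - exact: supported_im_part.
apply: lty_intg; first by move=> x; exact: sqr_ge0.
apply: (@ae_intg _ _ _ mu _ (fun x => modulus (u x) ^+ 2) mm _ (intgD ja jb)).
by apply: ae_mono aeab => x ->.
Qed.

Lemma sqr_modulus_fourier u z : cmeasurable u -> vanishing u ->
  sq_integrable (re_part u) -> sq_integrable (im_part u) ->
  modulus (fourier u z) ^+ 2 = spectral_density (re_part u) z +
    spectral_density (im_part u) z + 2 * cross_density (re_part u) (im_part u) z.
Proof.
move=> mu_ vu /sq_integrable_intg ja /sq_integrable_intg jb.
by rewrite fourierE// sqr_modulus /= /spectral_density /cross_density; ring.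
Qed.

Definition sobolev_weight z : R := Num.sqrt (1 + z ^+ 2).

Lemma measurable_sobolev_weight : measurable_fun setT sobolev_weight.
Proof.
apply: (measurableT_comp (f := @Num.sqrt R)).
  by apply: continuous_measurable_fun; exact: sqrt_continuous.
by apply: measurable_funD; [exact: measurable_cst|exact: measurable_funX].
Qed.

Lemma sobolev_weightN z : sobolev_weight (- z) = sobolev_weight z.
Proof. by rewrite /sobolev_weight sqrrN. Qed.

Lemma abs_le_sobolev_weight z : `|z| <= sobolev_weight z.
Proof. by rewrite -sqrtr_sqr ler_wsqrtr// lerDr. Qed.

(** With zero potential, [sobolev_le_quad] yields integrability against the Sobolev weight for every
    function of finite energy. *)
Lemma hardy_potential0 : hardy_potential (cst (0 : R)).
Proof. by exists 0; split=> // x _ _; rewrite mul0r. Qed.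

(* The cross term is odd, so it disappears after adding the values at [z] and
   [- z]. *)
Lemma H00P u : H00 u <-> [/\ cmeasurable u, vanishing u,
  finite_energy (re_part u) & finite_energy (im_part u)].
Proof.
split=> [[mu_ u2 vu uH]|[mu_ vu fa fb]].
  have [sa sb] := (sq_integrable_parts mu_ vu).1 u2.
  have ja := sq_integrable_intg sa; have jb := sq_integrable_intg sb.
  have E z := sqr_modulus_fourier z mu_ vu sa sb.
  have mG : measurable_fun setT (spectral_density (re_part u)) by exact: measurable_spectral_density.
  have mG' : measurable_fun setT (spectral_density (im_part u)) by exact: measurable_spectral_density.
  have mC : measurable_fun setT (cross_density (re_part u) (im_part u)) := measurable_funB
      (measurable_funM (measurable_sin_transform ja) (measurable_cos_transform jb))
      (measurable_funM (measurable_cos_transform ja) (measurable_sin_transform jb)).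
  have j : intg mu (fun z => sobolev_weight z * modulus (fourier u z) ^+ 2).
    apply: intg_lty => //.
      rewrite (_ : (fun z => _) = (fun z => sobolev_weight z * (spectral_density (re_part u) z +
         spectral_density (im_part u) z + 2 * cross_density (re_part u) (im_part u) z))).
        apply: measurable_funM; first exact: measurable_sobolev_weight.
        apply: measurable_funD; first exact: measurable_funD.
        exact: measurable_funM.
      by apply/funext => z; rewrite E.
    by move=> z; rewrite mulr_ge0 ?sqrtr_ge0 ?sqr_ge0.
  have jj := intgD j (intg_opp j).
  have le z : `|z| * (spectral_density (re_part u) z + spectral_density (im_part u) z) <=
      sobolev_weight z * modulus (fourier u z) ^+ 2 +
      sobolev_weight (- z) * modulus (fourier u (- z)) ^+ 2.
    rewrite sobolev_weightN -mulrDr !E !spectral_densityN// cross_densityN//.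
    have g0 := spectral_density_ge0 (re_part u) z.
    have g1 := spectral_density_ge0 (im_part u) z.
    have := abs_le_sobolev_weight z; have := normr_ge0 z.
    move: g0 g1; move: (spectral_density _ _) (spectral_density _ _) (cross_density _ _ _).
    by move: `|z| (sobolev_weight z) => t w p q r p0 q0 t0 tw; nra.
  split => //; split => //; apply: (@intg_le _ _ _ mu _ _ _ _ jj).
  - by apply: measurable_funM => //; exact: measurable_absR.
  - move=> z; rewrite ger0_norm ?mulr_ge0 ?spectral_density_ge0//; apply: le_trans (le z).
    by rewrite ler_wpM2l// lerDl spectral_density_ge0.
  - by apply: measurable_funM => //; exact: measurable_absR.
  - move=> z; rewrite ger0_norm ?mulr_ge0 ?spectral_density_ge0//; apply: le_trans (le z).
    by rewrite ler_wpM2l// lerDr spectral_density_ge0.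
have [sa ea] := fa; have [sb eb] := fb.
have ja := sq_integrable_intg sa; have jb := sq_integrable_intg sb.
split => //; first by apply/(sq_integrable_parts mu_ vu).
have [Ja _] := sobolev_le_quad hardy_potential0 fa.
have [Jb _] := sobolev_le_quad hardy_potential0 fb.
have [Jc _] := intg_cross_density measurable_sobolev_weight (fun z => sqrtr_ge0 _) sobolev_weightN
  ja jb Ja Jb.
apply: lty_intg; first by move=> z; rewrite mulr_ge0 ?sqrtr_ge0 ?sqr_ge0.
have := intgD (intgD Ja Jb) (intgZ 2 Jc); congr (intg _ _); apply/funext => z.
by rewrite sqr_modulus_fourier// /sobolev_weight; ring.
Qed.

Lemma sqr_H00_norm u : H00 u -> H00_norm u ^+ 2 =
  (2 * pi)^-1 * \int[mu]_z (sobolev_weight z * spectral_density (re_part u) z) +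
  (2 * pi)^-1 * \int[mu]_z (sobolev_weight z * spectral_density (im_part u) z).
Proof.
move=> /H00P[mu_ vu fa fb]; have [sa ea] := fa; have [sb eb] := fb.
have ja := sq_integrable_intg sa; have jb := sq_integrable_intg sb.
have [Ja _] := sobolev_le_quad hardy_potential0 fa.
have [Jb _] := sobolev_le_quad hardy_potential0 fb.
have [Jc Ic] := intg_cross_density measurable_sobolev_weight (fun z => sqrtr_ge0 _) sobolev_weightN
  ja jb Ja Jb.
rewrite /H00_norm sqr_sqrtr; last first.
  apply: mulr_ge0; first by rewrite invr_ge0 mulr_ge0// pi_ge0.
  by apply: Rintegral_ge0 => z _; rewrite mulr_ge0 ?sqrtr_ge0 ?sqr_ge0.
rewrite -mulrDr; congr (_ * _).
rewrite -[RHS]addr0 -(mulr0 2) -Ic -RintZ// -!RintD//; last 2 first.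
  exact: intgD.
  exact: intgZ.
by apply: eq_Rintegral => z _; rewrite sqr_modulus_fourier// /sobolev_weight; ring.
Qed.

End ComplexReduction.

(** * Lebesgue measurable potentials *)

Section NullSets.
Context d (T : measurableType d) (R : realType) (mu : {measure set T -> \bar R}).
Local Open Scope ereal_scope.

Import HBNNSimple.

Let ge0_integral_null_le (D N : set T) (f g : T -> \bar R) : measurable N -> mu N = 0 ->
  (forall x, 0 <= f x) -> (forall x, 0 <= g x) -> (forall x, ~ N x -> f x = g x) ->
  \int[mu]_(x in D) f x <= \int[mu]_(x in D) g x.
Proof.
move=> mN N0 f0 g0 fg; rewrite !ge0_integralE//.
apply: ge_ereal_sup => _ [h /= hf <-].
pose k := proj_nnsfun h (measurableC mN).
apply: (@le_trans _ _ (sintegral mu k)); last first.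
  apply: ereal_sup_ubound; exists k => // x /=.
  rewrite mindicE; have [xN|xN] := pselect (N x).
    by rewrite memNset ?mulr0 ?patchE//; case: ifP.
  by rewrite mem_set// mulr1; have := hf x; rewrite !patchE; case: ifP => // _; rewrite fg.
rewrite le_eqVlt; apply/orP; left; apply/eqP; rewrite -!integralT_nnsfun.
apply: ge0_ae_eq_integral => //.
- by apply/measurable_EFinP.
- by apply/measurable_EFinP.
- by move=> x _; rewrite lee_fin.
- by move=> x _; rewrite lee_fin.
exists N; split => // x /= /not_implyP[_]; apply: contra_notP => xN.
by rewrite mindicE mem_set// mulr1.
Qed.

(* No measurability is needed: the integral of a nonnegative function is a supremum
   over simple functions, and these may be set to zero on [N]. *)
Lemma integral_null_eq (D N : set T) (f g : T -> \bar R) : measurable N -> mu N = 0 ->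
  (forall x, ~ N x -> f x = g x) ->
  \int[mu]_(x in D) f x = \int[mu]_(x in D) g x.
Proof.
move=> mN N0 fg; rewrite integralE [RHS]integralE.
have fgp x : ~ N x -> f^\+ x = g^\+ x by move=> /fg; rewrite !funeposE => ->.
have fgn x : ~ N x -> f^\- x = g^\- x by move=> /fg; rewrite !funenegE => ->.
have sym (p q : T -> \bar R) : (forall x, ~ N x -> p x = q x) ->
  forall x, ~ N x -> q x = p x by move=> H x xN; rewrite H.
congr (_ - _); apply/eqP; rewrite eq_le; apply/andP; split;
  apply: (ge0_integral_null_le _ mN N0) => //; exact: sym.
Qed.

End NullSets.

(** * A Borel version of the potential *)

Section BorelVersion.
Context {R : realType}.
Local Notation mu := (@lebesgue_measure R).
Implicit Types (V W : R -> R) (D : set R).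

(** An enumeration of the rationals; an index that codes none merely repeats 0. *)
Let rational n : R := ratr (odflt 0 (@unpickle rat n)).

Let rational_between (r s : R) : r < s -> exists n, r < rational n < s.
Proof.
move=> rs; have [q /=] := rat_in_itvoo rs; rewrite in_itv /= => qI.
by exists (pickle q); rewrite /rational pickleK.
Qed.

Lemma borel_version V D : measurable D -> lebesgue_measurable_fun D V ->
  exists N, [/\ measurable N, mu N = 0 & measurable_fun (D `\` N) V].
Proof.
move=> mD mV.
have mD' : (completed_algebra_gen mu).-sigma.-measurable D.
  by apply: sub_sigma_algebra; exists D => //; exists set0; [exact: negligible_set0|rewrite setU0].
have H n : exists AM : set R * set R, [/\ measurable AM.1, measurable AM.2, mu AM.2 = 0 &
    AM.1 `<=` D `&` V @^-1` `]rational n, +oo[ /\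
    D `&` V @^-1` `]rational n, +oo[ `<=` AM.1 `|` AM.2].
  have := mV mD' `]rational n, +oo[%classic (measurable_itv _).
  (* A Lebesgue measurable set is a Borel set [A] together with a part [Z] of a Borel null set
     [M]. *)
  rewrite [X in X _ -> _]g_sigma_completed_algebra_genE => -[A mA [Z [M [mM M0 ZM]] E]].
  exists (A, M); split => //=; rewrite -E; split; first by move=> x Ax; left.
  by move=> x [Ax|Zx]; [left|right; exact: ZM].
have [AM HAM] := choice H.
pose N := \bigcup_n (AM n).2.
have mN : measurable N by apply: bigcupT_measurable => n; have [] := HAM n.
exists N; split => //.
  apply/negligibleP => //; apply: negligible_bigcup => n.
  by apply/negligibleP; have [] := HAM n.
apply: (measurability _ (RGenOInfty.measurableE R)) => _ [_ [r ->] <-].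
(* The set V > r is the union of the sets V > q over rational q > r, and off [N] each of them
   coincides with its Borel part. *)
rewrite (_ : _ `&` _ = \bigcup_(n in [set n | r < rational n]) ((AM n).1 `\` N)).
  by apply: bigcup_measurable => n _; apply: measurableD => //; have [] := HAM n.
apply/seteqP; split => x /=.
  move=> [[Dx Nx]]; rewrite in_itv /= andbT => rV.
  have [n /andP[rn nV]] := rational_between rV.
  exists n => //=; split => //.
  have [_ _ _ [_ sub]] := HAM n.
  have [//|Mx] : ((AM n).1 `|` (AM n).2) x by apply: sub; split => //=; rewrite in_itv /= nV.
  by case: Nx; exists n.
move=> [n /= rn [Ax Nx]]; have [_ _ _ [sub _]] := HAM n.
have [Dx /=] := sub x Ax; rewrite in_itv /= andbT => nV.
by split => //; rewrite in_itv /= andbT; exact: lt_trans nV.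
Qed.

Lemma hardy_potential_version V (M : R) :
  lebesgue_measurable_fun `]-1, 1[%classic V ->
  {ae mu, forall x, `]-1, 1[%classic x -> 0 <= V x} ->
  {ae mu, forall x, `]-1, 1[%classic x -> (1 - x ^+ 2) * V x <= M} ->
  exists W N, [/\ hardy_potential W, measurable N, mu N = 0 &
    forall x, ~ N x -> `]-1, 1[%classic x -> V x = W x].
Proof.
move=> mV V0 VM.
have mD : measurable (`]-1, 1[%classic : set R) by exact: measurable_itv.
have [N1 [mN1 N10 mV1]] := borel_version mD mV.
have [N2 [mN2 N20 sN2]] := ae_and V0 VM.
pose N := N1 `|` N2.
have mN : measurable N by exact: measurableU.
have H x : ~ N x -> `]-1, 1[%classic x -> 0 <= V x /\ (1 - x ^+ 2) * V x <= M.
  move=> xN xD; have : ~ N2 x by move=> ?; apply: xN; right.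
  by move=> /(contra_not (@sN2 x)) /contrapT /= [h1 h2]; split; [exact: h1|exact: h2].
pose W := V \_ (`]-1, 1[%classic `\` N).
have WE x : ~ N x -> `]-1, 1[%classic x -> W x = V x.
  by move=> xN xD; rewrite /W patchE mem_set.
have W0 x : ~ (`]-1, 1[%classic `\` N) x -> W x = 0.
  by move=> xN; rewrite /W patchE memNset.
exists W, N; split => //; last 2 first.
- by rewrite null_set_setU.
- by move=> x xN xD; rewrite WE.
(* The absolute value keeps the bound nonnegative where [W] was set to 0. *)
exists `|M|; split.
- have mDN : measurable (`]-1, 1[%classic `\` N) by exact: measurableD.
  apply/(measurable_restrictT _ mDN); apply: measurable_funS mV1; first exact: measurableD.
  by move=> x [Dx Nx]; split => // N1x; apply: Nx; left.
- move=> x; have [[xD xN]|h] := pselect ((`]-1, 1[%classic `\` N) x); last by rewrite W0.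
  by rewrite WE//; have [] := H x xN xD.
- move=> x; rewrite /= in_itv /= => /andP[h1 h2] d.
  have d0 : 0 < 1 - x ^+ 2 by rewrite lt_neqAle eq_sym d /=; nra.
  have [[xD xN]|h] := pselect ((`]-1, 1[%classic `\` N) x); last first.
    by rewrite W0// divr_ge0// ltW.
  rewrite WE// ler_pdivlMr// mulrC; have [_ h3] := H x xN xD.
  exact: le_trans h3 (ler_norm _).
Qed.

End BorelVersion.

(** * The sesquilinear form and its real part *)

Section ComplexForm.
Context {R : realType}.
Local Notation mu := (@lebesgue_measure R).
Local Notation Re := complex.Re.
Local Notation Im := complex.Im.
Local Notation modulus := ComplexField.Normc.normc.
Local Open Scope complex_scope.
Implicit Types (u v g : R -> R[i]) (z x : R).

(** Scalars are real: Riesz's theorem is applied to H00 as a real space, with the real part of the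
    sesquilinear form. *)
Definition comb u (c : R) v : R -> R[i] := fun x => u x + c%:C * v x.

Lemma re_part_comb u c v : re_part (comb u c v) = (fun x => re_part u x + c * re_part v x).
Proof. by apply/funext => x; rewrite /re_part /comb cReD cReM /=; ring. Qed.

Lemma im_part_comb u c v : im_part (comb u c v) = (fun x => im_part u x + c * im_part v x).
Proof. by apply/funext => x; rewrite /im_part /comb cImD cImM /=; ring. Qed.

Lemma comb_sub u v : comb u 1 (comb v (-1) u) = v.
Proof.
by apply/funext => x; apply: complex_ext; rewrite /comb !(cReD, cImD, cReM, cImM) /=; ring.
Qed.

Lemma H00_comb u c v : H00 u -> H00 v -> H00 (comb u c v).
Proof.
move=> /H00P[[mu1 mu2] vu fa fb] /H00P[[mv1 mv2] vv fa' fb']; apply/H00P; split.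
- split.
  + rewrite (_ : (fun x => _) = (fun x => Re (u x) + c * Re (v x))).
      by apply: measurable_funD => //; exact: measurable_funM.
    by apply/funext => x; rewrite /comb cReD cReM /=; ring.
  + rewrite (_ : (fun x => _) = (fun x => Im (u x) + c * Im (v x))).
      by apply: measurable_funD => //; exact: measurable_funM.
    by apply/funext => x; rewrite /comb cImD cImM /=; ring.
- by apply: ae_mono (ae_and vu vv) => x [h1 h2] xI; rewrite /comb h1// h2// mulr0 addr0.
- by rewrite re_part_comb; exact: finite_energyD.
- by rewrite im_part_comb; exact: finite_energyD.
Qed.

Definition imul g : R -> R[i] := fun x => 'i * g x.

Lemma re_part_imul g : re_part (imul g) = (fun x => -1 * im_part g x).
Proof. by apply/funext => x; rewrite /re_part /im_part /imul cReM /=; ring. Qed.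

Lemma im_part_imul g : im_part (imul g) = re_part g.
Proof. by apply/funext => x; rewrite /re_part /im_part /imul cImM /=; ring. Qed.

Lemma H00_imul g : H00 g -> H00 (imul g).
Proof.
move=> /H00P[[m1 m2] vg fa fb]; apply/H00P; split.
- split.
  + rewrite (_ : (fun x => _) = (fun x => -1 * Im (g x))); first exact: measurable_funM.
    by apply/funext => x; rewrite /imul cReM /=; ring.
  + rewrite (_ : (fun x => _) = (fun x => Re (g x))) //.
    by apply/funext => x; rewrite /imul cImM /=; ring.
- by apply: ae_mono vg => x h xI; rewrite /imul h// mulr0.
- by rewrite re_part_imul; exact: finite_energyZ.
- by rewrite im_part_imul.
Qed.

Lemma finite_energy0 : finite_energy (fun _ : R => 0 : R).
Proof.
have j0 : intg mu (fun _ : R => 0 : R) by exact: integrable0.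
split; first split.
- exact: measurable_cst.
- by under eq_fun do rewrite expr0n.
- by [].
have -> : (fun z : R => `|z| * spectral_density (fun=> 0) z) = fun=> 0.
  apply/funext => z; rewrite /spectral_density /cos_transform /sin_transform.
  under eq_Rintegral do rewrite mul0r.
  under [X in _ * (_ + X ^+ 2)]eq_Rintegral do rewrite mul0r.
  by rewrite Rintegral_cst// mul0r expr0n addr0 mulr0.
exact: j0.
Qed.

Lemma H00_0 : H00 (fun _ : R => 0 : R[i]).
Proof.
have E1 : re_part (fun _ : R => 0 : R[i]) = fun=> 0.
  by apply/funext => x; rewrite /re_part mul0r.
have E2 : im_part (fun _ : R => 0 : R[i]) = fun=> 0.
  by apply/funext => x; rewrite /im_part mul0r.
apply/H00P; split.
- by split; exact: measurable_cst.
- exact: aeW.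
- by rewrite E1; exact: finite_energy0.
- by rewrite E2; exact: finite_energy0.
Qed.

Lemma fourier_imul g z : H00 g -> fourier (imul g) z = 'i * fourier g z.
Proof.
move=> Hg; have /H00P[mg vg [sa _] [sb _]] := Hg.
have ja := sq_integrable_intg sa; have jb := sq_integrable_intg sb.
have /H00P[mr vr [sra _] [srb _]] := H00_imul Hg.
rewrite !fourierE//; try exact: sq_integrable_intg.
have j0 := sq_integrable_intg finite_energy0.1.
have c0 (a : R -> R) : intg mu a -> cos_transform (fun x => -1 * a x) z = - cos_transform a z.
  move=> j; rewrite -[RHS]mulN1r /cos_transform -RintZ; last exact: intg_mul_cos.
  by apply: eq_Rintegral => x _; ring.
have s0 (a : R -> R) : intg mu a -> sin_transform (fun x => -1 * a x) z = - sin_transform a z.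
  move=> j; rewrite -[RHS]mulN1r /sin_transform -RintZ; last exact: intg_mul_sin.
  by apply: eq_Rintegral => x _; ring.
rewrite re_part_imul im_part_imul c0// s0//.
by apply: complex_ext; rewrite ?cReM ?cImM /=; ring.
Qed.

Definition weak_form (V : R -> R) u g : R[i] :=
  cintegral `]-1, 1[%classic (fun x => (V x)%:C * u x * conjc (g x))
    + ((4 * pi)^-1)%:C *
      cintegral setT (fun z => (`|z|)%:C * fourier u z * conjc (fourier g z)).

Lemma Re_scale (c : R) (p : R[i]) : Re (c%:C * p) = c * Re p.
Proof. by rewrite cReM /=; ring. Qed.

Lemma Im_scale (c : R) (p : R[i]) : Im (c%:C * p) = c * Im p.
Proof. by rewrite cImM /=; ring. Qed.

Lemma Re_cintegral (D : set R) u : Re (cintegral D u) = \int[mu]_(x in D) Re (u x).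
Proof. by []. Qed.

Lemma Im_cintegral (D : set R) u : Im (cintegral D u) = \int[mu]_(x in D) Im (u x).
Proof. by []. Qed.

(** The form is antilinear in [g], and the real part of - i p is the imaginary part of p. The
    pairing has the same property, so the real part of the weak equation determines all of it. *)
Lemma Im_weak_form V u g : H00 g -> Im (weak_form V u g) = Re (weak_form V u (imul g)).
Proof.
move=> Hg; rewrite /weak_form cReD cImD Re_scale Im_scale !Re_cintegral !Im_cintegral.
congr (_ + _ * _); apply: eq_Rintegral => x _.
  by rewrite /imul !(cReM, cImM, cReJ, cImJ) /=; ring.
rewrite fourier_imul//; move: (fourier u x) (fourier g x) => p q.
by rewrite !(cReM, cImM, cReJ, cImJ) /=; ring.
Qed.

Variables (V W : R -> R) (N : set R).
Hypotheses (hW : hardy_potential W) (mN : measurable N) (N0 : mu N = 0)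
  (VW : forall x, ~ N x -> `]-1, 1[%classic x -> V x = W x).

Definition complex_form u g : R :=
  real_form W (re_part u) (re_part g) + real_form W (im_part u) (im_part g).

Lemma Re_weak_form u g : H00 u -> H00 g -> Re (weak_form V u g) = complex_form u g.
Proof.
move=> Hu Hg; have /H00P[mu_ vu fa fb] := Hu; have /H00P[mg vg fa' fb'] := Hg.
have ja := sq_integrable_intg fa.1; have jb := sq_integrable_intg fb.1.
have ja' := sq_integrable_intg fa'.1; have jb' := sq_integrable_intg fb'.1.
rewrite /weak_form cReD Re_scale.
have -> : Re (cintegral `]-1, 1[%classic (fun x => (V x)%:C * u x * conjc (g x))) =
    \int[mu]_x (W x * (re_part u x * re_part g x)) +
    \int[mu]_x (W x * (im_part u x * im_part g x)).
  rewrite Re_cintegral -RintD; [|exact: intg_potential|exact: intg_potential].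
  cbv beta.
  rewrite Rintegral_mkcond; congr fine.
  (* The endpoints join the null set because the weak equation integrates over the open interval,
     while [chi] is the indicator of the closed one. *)
  pose N' := N `|` ([set 1] `|` [set -1]).
  have m1 : measurable ([set 1] `|` [set -1] : set R).
    by apply: measurableU; exact: measurable_set1.
  apply: (@integral_null_eq _ _ _ mu _ N').
  - exact: measurableU.
  - rewrite null_set_setU//; rewrite null_set_setU//; exact: lebesgue_measure_set1 || exact: measurable_set1.
  - move=> x xN; rewrite patchE; case: ifPn => [/set_mem xD|/negP xD].
      have xI : `[-1, 1]%classic x by apply: subset_itv_oo_cc xD.
      rewrite /re_part /im_part !chi_in// -VW//; last by move=> ?; apply: xN; left.
      by rewrite !(cReM, cImM, cReJ, cImJ) /=; congr EFin; ring.
    have xI : ~ `[-1, 1]%classic x.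
      move=> xI; apply: xD; apply: mem_set; move: xI; rewrite /= !in_itv /= !le_eqVlt.
      move=> /andP[/predU1P[e|->] /predU1P[e'|->]] //; exfalso; apply: xN; right.
      + by left; rewrite /= -e'.
      + by right; rewrite /= -e.
      + by left; rewrite /= e'.
    by rewrite /re_part /im_part !chi_out// !mulr0 addr0.
have -> : Re (cintegral setT (fun z => (`|z|)%:C * fourier u z * conjc (fourier g z))) =
    \int[mu]_z (`|z| * spectral_form (re_part u) (re_part g) z) +
    \int[mu]_z (`|z| * spectral_form (im_part u) (im_part g) z).
  rewrite Re_cintegral; cbv beta; have mab := @measurable_absR R.
  have absN (z : R) : `|- z| = `|z| by rewrite normrN.
  (* The real part of the product of transforms contains two cross densities, pairing the real part
     of one function with the imaginary part of the other; both integrate to 0. *)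
  have [c1 I1] := intg_cross_density mab (fun z => normr_ge0 z) absN ja jb' fa.2 fb'.2.
  have [c2 I2] := intg_cross_density mab (fun z => normr_ge0 z) absN ja' jb fa'.2 fb.2.
  have s1 := intg_spectral_form fa fa'; have s2 := intg_spectral_form fb fb'.
  rewrite -[RHS]addr0 -[X in _ + X]addr0 -{1}I1 -I2 -(RintD s1 s2) -(RintD c1 c2).
  rewrite -(RintD (intgD s1 s2) (intgD c1 c2)).
  apply: eq_Rintegral => z _; rewrite !fourierE// !(cReM, cImM, cReJ, cImJ) /=.
  by rewrite /spectral_form /cross_density; ring.
rewrite /complex_form /real_form.
by move: (Rintegral _ _ _) (Rintegral _ _ _) (Rintegral _ _ _) (Rintegral _ _ _) => *; ring.
Qed.

End ComplexForm.

(** * Weak solutions *)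

Section Solvability.
Context {R : realType}.
Local Notation mu := (@lebesgue_measure R).
Local Notation Re := complex.Re.
Local Notation Im := complex.Im.
Local Notation modulus := ComplexField.Normc.normc.
Local Open Scope complex_scope.
Implicit Types (u v g : R -> R[i]) (z x : R).

Variable W : R -> R.
Hypothesis hW : hardy_potential W.
Local Notation form := (complex_form W).

Lemma complex_form_ge0 u : 0 <= form u u.
Proof. by rewrite addr_ge0//; exact: real_quad_ge0. Qed.

Lemma complex_formC u v : form u v = form v u.
Proof. by rewrite /complex_form (real_formC W (re_part u)) (real_formC W (im_part u)). Qed.

Lemma complex_form_comb u c v g : H00 u -> H00 v -> H00 g ->
  form (comb u c v) g = form u g + c * form v g.
Proof.
move=> /H00P[_ _ fa fb] /H00P[_ _ fa' fb'] /H00P[_ _ fa'' fb''].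
rewrite /complex_form re_part_comb im_part_comb.
rewrite (real_formDl hW c fa fa' fa'') (real_formDl hW c fb fb' fb'').
move: (real_form W (re_part u) _) (real_form W (re_part v) _).
by move: (real_form W (im_part u) _) (real_form W (im_part v) _) => *; ring.
Qed.

Lemma H00_norm_ge0 u : 0 <= H00_norm u.
Proof. exact: sqrtr_ge0. Qed.

Lemma H00_norm_le_form u : H00 u -> H00_norm u ^+ 2 <= (2 * pi + 2) * form u u.
Proof.
move=> Hu; rewrite sqr_H00_norm// /complex_form [leRHS]mulrDr.
have /H00P[_ _ fa fb] := Hu.
by apply: lerD; [have [] := sobolev_le_quad hW fa|have [] := sobolev_le_quad hW fb].
Qed.

Lemma complex_complete (u_ : nat -> R -> R[i]) : (forall n, H00 (u_ n)) ->
  (forall n m, (n <= m)%N ->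
     form (comb (u_ m) (-1) (u_ n)) (comb (u_ m) (-1) (u_ n)) <= 4^-1 ^+ n) ->
  exists2 u, H00 u & forall n,
     form (comb u (-1) (u_ n)) (comb u (-1) (u_ n)) <= 4 * 4^-1 ^+ n.
Proof.
move=> Hu hq.
have fa n : finite_energy (re_part (u_ n)) by have /H00P[] := Hu n.
have fb n : finite_energy (im_part (u_ n)) by have /H00P[] := Hu n.
have ha n m : (n <= m)%N ->
    real_quad W (fun x => re_part (u_ m) x + -1 * re_part (u_ n) x) <= 4^-1 ^+ n.
  move=> nm; apply: le_trans (hq n m nm); rewrite /complex_form re_part_comb im_part_comb.
  by rewrite lerDl; exact: real_quad_ge0.
have hb n m : (n <= m)%N ->
    real_quad W (fun x => im_part (u_ m) x + -1 * im_part (u_ n) x) <= 4^-1 ^+ n.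
  move=> nm; apply: le_trans (hq n m nm); rewrite /complex_form re_part_comb im_part_comb.
  by rewrite lerDr; exact: real_quad_ge0.
have [a Fa Ha] := real_complete hW fa ha; have [b Fb Hb] := real_complete hW fb hb.
pose u x : R[i] := a x +i* b x.
have [[ma _ sa] _] := Fa; have [[mb _ sb] _] := Fb.
have Ea : re_part u = a by apply/funext => x; exact: supported_chi.
have Eb : im_part u = b by apply/funext => x; exact: supported_chi.
exists u.
  apply/H00P; split; [by split| |by rewrite Ea|by rewrite Eb].
  by apply: aeW => x xI; rewrite /u sa// sb.
move=> n; rewrite /complex_form re_part_comb im_part_comb Ea Eb.
apply: le_trans (lerD (Ha n) (Hb n)) _.
by rewrite -mulrDl ler_wpM2r ?exprn_ge0 ?invr_ge0//; lra.
Qed.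

Lemma form_eq0 u : H00 u -> form u u = 0 -> {ae mu, forall x, u x = 0}.
Proof.
move=> Hu; have /H00P[mu_ vu fa fb] := Hu; rewrite /complex_form => h.
have h1 := real_quad_ge0 hW (re_part u); have h2 := real_quad_ge0 hW (im_part u).
have z (a : R -> R) : finite_energy a -> real_quad W a = 0 -> {ae mu, forall x, a x = 0}.
  move=> Fa Qa; have := sq_norm_le_quad hW Fa; rewrite Qa mulr0 => le0.
  have [[_ ja _] _] := Fa.
  have sq0 x : 0 <= a x ^+ 2 by exact: sqr_ge0.
  have I0 : \int[mu]_x (a x ^+ 2) = 0.
    by apply/eqP; rewrite eq_le le0 /=; apply: Rintegral_ge0 => x _.
  apply: (@ae_mono _ _ _ mu (fun x => a x ^+ 2 = 0)); last exact: Rint_eq0_ae ja I0.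
  by move=> x /eqP; rewrite sqrf_eq0 => /eqP.
move/eqP: h; rewrite (paddr_eq0 h1 h2) => /andP[/eqP qa /eqP qb].
have za := z _ fa qa; have zb := z _ fb qb.
apply: ae_mono (ae_and (ae_and (ae_re_part vu) (ae_im_part vu)) (ae_and za zb)).
move=> x [[e1 e2] [e3 e4]].
by apply: complex_ext; rewrite ?e1 ?e2 ?e3 ?e4.
Qed.

(** Read contrapositively, it admits every function of positive norm to the supremum that defines
    the dual norm. *)
Lemma ae0_H00_norm u : H00 u -> {ae mu, forall x, u x = 0} -> H00_norm u = 0.
Proof.
move=> Hu u0; have /H00P[mu_ vu [[ma _ sa] _] [[mb _ sb] _]] := Hu.
have z (a : R -> R) t : measurable_fun setT a -> {ae mu, forall x, a x = 0} ->
    spectral_density a t = 0.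
  move=> m a0.
  have I (k : R -> R) : measurable_fun setT k -> \int[mu]_x (a x * k x) = 0.
    move=> mk; rewrite (@ae_Rint _ _ _ mu _ (cst 0)) ?Rintegral_cst ?mul0r//.
      exact: measurable_funM.
    by apply: ae_mono a0 => x ->; rewrite mul0r.
  have mc : measurable_fun setT (fun x : R => cos (x * t)).
    exact: (measurable_fun_pair1 _ measurable_cos_kernel).
  have ms : measurable_fun setT (fun x : R => sin (x * t)).
    exact: (measurable_fun_pair1 _ measurable_sin_kernel).
  by rewrite /spectral_density /cos_transform /sin_transform !I// expr0n addr0.
have Z (a : R -> R) : measurable_fun setT a -> {ae mu, forall x, a x = 0} ->
    \int[mu]_z (sobolev_weight z * spectral_density a z) = 0.
  move=> m a0; under eq_Rintegral do rewrite z// mulr0.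
  by rewrite Rintegral_cst// mul0r.
apply/eqP; rewrite -sqrf_eq0 sqr_H00_norm// !Z ?mulr0 ?addr0//.
- by apply: ae_mono u0 => x ux; rewrite /im_part ux mul0r.
- by apply: ae_mono u0 => x ux; rewrite /re_part ux mul0r.
Qed.

End Solvability.

(** * The pairing and the dual norm *)

Section Duality.
Context {R : realType}.
Local Notation mu := (@lebesgue_measure R).
Local Notation Re := complex.Re.
Local Notation Im := complex.Im.
Local Notation modulus := ComplexField.Normc.normc.
Local Open Scope complex_scope.
Variable f : (R -> R[i]) -> R[i].
Hypothesis f_dual : H00_dual f.
Implicit Types (u v g : R -> R[i]).

Lemma pairing_extension : H00_extension f (pairing f).
Proof. by have [_ [F HF]] := f_dual; apply: (xgetPex _ (ex_intro _ F HF)). Qed.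

Lemma pairing_comb u c v : H00 u -> H00 v ->
  pairing f (comb u c v) = pairing f u + c%:C * pairing f v.
Proof.
move=> Hu Hv; have [anti _ _] := pairing_extension.
have := anti c%:C v u Hv Hu; rewrite conjc_real addrC => <-.
by congr (pairing f _); apply/funext => x; rewrite addrC.
Qed.

Lemma pairing0 : pairing f (fun=> 0) = 0.
Proof.
have [anti _ _] := pairing_extension.
have := anti (-1) _ _ (@H00_0 R) (@H00_0 R).
rewrite (_ : (fun x : R => -1 * 0 + 0) = fun=> 0 :> R[i]).
  by rewrite rmorphN1 mulN1r addNr.
by apply/funext => x; rewrite mulr0 addr0.
Qed.

Lemma Re_pairing_imul g : H00 g -> Re (pairing f (imul g)) = Im (pairing f g).
Proof.
move=> Hg; have [anti _ _] := pairing_extension.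
have := anti 'i _ _ Hg (@H00_0 R); rewrite pairing0 addr0.
rewrite (_ : (fun x => 'i * g x + 0) = imul g); last by apply/funext => x; rewrite addr0.
by move=> ->; rewrite cReM /=; ring.
Qed.

Lemma pairing_bounded : exists2 C, 0 <= C &
  forall g, H00 g -> modulus (pairing f g) <= C * H00_norm g.
Proof.
have [_ [C HC] _] := pairing_extension; exists `|C|; first exact: normr_ge0.
move=> g Hg; apply: le_trans (HC g Hg) _.
by rewrite ler_wpM2r ?H00_norm_ge0// ler_norm.
Qed.

Lemma has_ubound_dual : has_ubound [set modulus (pairing f g) / H00_norm g |
  g in [set g | H00 g /\ ~ (g = (fun _ => 0) %[ae mu])]].
Proof.
have [C C0 HC] := pairing_bounded; exists C => _ [g [Hg _] <-].
(* A quotient with zero denominator is 0 by convention and respects the bound. *)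
have [->|n0] := eqVneq (H00_norm g) 0; first by rewrite invr0 mulr0.
by rewrite ler_pdivrMr ?HC// lt_neqAle eq_sym n0 H00_norm_ge0.
Qed.

Lemma H00_dual_norm_ge0 : 0 <= H00_dual_norm f.
Proof.
rewrite /H00_dual_norm; set S := [set _ | _ in _].
have [[s Ss]|/nonemptyPn ->] := pselect (S !=set0); last by rewrite sup0.
apply: (@le_trans _ _ s); last by apply: ub_le_sup; [exact: has_ubound_dual|].
by case: Ss => g _ <-; rewrite divr_ge0 ?H00_norm_ge0 ?modulus_ge0.
Qed.

Lemma modulus_pairing_le g : H00 g -> 0 < H00_norm g ->
  modulus (pairing f g) <= H00_dual_norm f * H00_norm g.
Proof.
move=> Hg n0; rewrite -ler_pdivrMr//; apply: ub_le_sup; first exact: has_ubound_dual.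
exists g => //; split => // g0.
have : H00_norm g = 0 by apply: ae0_H00_norm => //; apply: ae_mono g0 => x /(_ I).
by move=> e; rewrite e ltxx in n0.
Qed.

End Duality.

Theorem theorem1p3 (R : realType) (V : R -> R) (M : R)
  (V_meas : lebesgue_measurable_fun `]-1, 1[%classic V)
  (V_ge0 : {ae @lebesgue_measure R, forall x, `]-1, 1[%classic x -> 0 <= V x})
  (V_le : {ae @lebesgue_measure R,
             forall x, `]-1, 1[%classic x -> (1 - x ^+ 2) * V x <= M})
  (f : (R -> complex R) -> complex R) (f_dual : H00_dual f) :
  exists u : R -> complex R,
    [/\ weak_solution V f u,
        forall w : R -> complex R, weak_solution V f w -> w = u %[ae @lebesgue_measure R] &
        H00_norm u <= (2 * pi + 2) * H00_dual_norm f].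
Proof.
have [W [N [hW mN N0 VW]]] := hardy_potential_version V_meas V_ge0 V_le.
pose l g := complex.Re (pairing f g).
have [C C0 HC] := pairing_bounded f_dual.
have ReE u g : H00 u -> H00 g -> complex.Re (weak_form V u g) = complex_form W u g.
  by move=> Hu Hg; exact: (Re_weak_form hW mN N0 VW Hu Hg).
have [|||||||||u Hu Eu] := @riesz_representation R (R -> complex R) H00 comb (complex_form W) l.
- by exists (fun=> 0); exact: H00_0.
- exact: H00_comb.
- exact: complex_form_comb.
- by move=> u v _ _; exact: complex_formC.
- by move=> u _; exact: complex_form_ge0.
- by move=> u c v Hu Hv; rewrite /l pairing_comb// cReD Re_scale.
- exists (C ^+ 2 * (2 * pi + 2)) => g Hg.
  apply: (@le_trans _ _ ((C * H00_norm g) ^+ 2)).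
    rewrite -real_normK ?num_real// ler_sqr ?nnegrE ?mulr_ge0 ?H00_norm_ge0//.
    by apply: le_trans (HC g Hg); exact: Re_le_modulus.
  by rewrite exprMn -[leRHS]mulrA ler_wpM2l ?sqr_ge0// H00_norm_le_form.
- exact: comb_sub.
- exact: complex_complete.
exists u; split.
- split => // g Hg; suff : weak_form V u g = pairing f g by [].
  have Hig := H00_imul Hg; apply: complex_ext; first by rewrite (ReE _ _ Hu Hg) (Eu _ Hg).
  rewrite (Im_weak_form V u Hg) (ReE _ _ Hu Hig) (Eu _ Hig).
  exact: Re_pairing_imul.
- move=> w [Hw Ew].
  (* Both equations are tested with the difference w - u; coercivity then forces it to vanish almost
     everywhere. *)
  have Hwu := H00_comb (-1) Hw Hu.
  have e0 : complex_form W (comb w (-1) u) (comb w (-1) u) = 0.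
    rewrite (complex_form_comb hW (-1) Hw Hu Hwu) (Eu _ Hwu) -(ReE _ _ Hw Hwu).
    have -> : weak_form V w (comb w (-1) u) = pairing f (comb w (-1) u) by exact: Ew.
    by rewrite mulN1r subrr.
  apply: ae_mono (form_eq0 hW Hwu e0) => x; rewrite /comb => wx _.
  apply/eqP; rewrite -subr_eq0 -wx; apply/eqP.
  by apply: complex_ext; rewrite !(cReD, cImD, cReM, cImM) /=; ring.
- have D0 := H00_dual_norm_ge0 f_dual.
  have pi0 : 0 < pi :> R by exact: pi_gt0.
  have [->|n0] := eqVneq (H00_norm u) 0.
    by rewrite mulr_ge0// addr_ge0// mulr_ge0// ltW.
  have n1 : 0 < H00_norm u by rewrite lt_neqAle eq_sym n0 H00_norm_ge0.
  (* For [g = u] the form equals the real part of the pairing, which the dual norm times the norm of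
     [u] bounds; one factor of the norm then cancels. *)
  have h1 := H00_norm_le_form hW Hu; rewrite (Eu u Hu) in h1.
  have h2 : l u <= H00_dual_norm f * H00_norm u.
    apply: le_trans (modulus_pairing_le f_dual Hu n1).
    by apply: le_trans (ler_norm _) (Re_le_modulus _).
  rewrite -(ler_pM2r n1) -expr2; apply: le_trans h1 _.
  by rewrite -[leRHS]mulrA ler_wpM2l// addr_ge0// mulr_ge0// ltW.
Qed.
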